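(* Let $\ell\in\frac12\mathbb{N}$, $\ell>0$, and $\nu>0$, let $\langle\cdot,\cdot\rangle^{(\nu)}$, $\Phi^{(\nu)}$, $\Psi^{(\nu)}$ be as defined in the context, and put $$c^{(\nu)}=\frac{(2\nu+1)(2\ell+\nu+1)\,\ell^2}{\nu(2\nu+2\ell+1)(2\ell+\nu)(\ell+\nu)}.$$ (i) Define the first order matrix-valued differential operator $S^{(\nu)}$ by $$(QS^{(\nu)})(x)=\frac{dQ}{dx}(x)\bigl(\Phi^{(\nu)}(x)\bigr)^\ast+Q(x)\bigl(\Psi^{(\nu)}(x)\bigr)^\ast.$$ Then $\bigl\langle\frac{dP}{dx},Q\bigr\rangle^{(\nu+1)}=-c^{(\nu)}\langle P,QS^{(\nu)}\rangle^{(\nu)}$ for all matrix-valued functions $P,Q$ with $C^1([-1,1])$-entries. (ii) Let $\mathscr{D}^{(\nu)}$ be the second order operator $(P\mathscr{D}^{(\nu)})(x)=\frac{d^2P}{dx^2}(x)\bigl(\Phi^{(\nu)}(x)\bigr)^\ast+\frac{dP}{dx}(x)\bigl(\Psi^{(\nu)}(x)\bigr)^\ast$. Then $$\langle P\mathscr{D}^{(\nu)},Q\rangle^{(\nu)}=-\frac{1}{c^{(\nu)}}\Bigl\langle\frac{dP}{dx},\frac{dQ}{dx}\Bigr\rangle^{(\nu+1)}$$ for all matrix-valued functions $P,Q$ with $C^2([-1,1])$-entries.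
   Context: Matrices are $(2\ell+1)\times(2\ell+1)$, indexed by $\{0,1,\dots,2\ell\}$; $E_{i,j}$ are the matrix units; $(a)_0=1$, $(a)_n=a(a+1)\cdots(a+n-1)$; derivatives are entrywise; $A^\ast$ is the conjugate transpose. The Gegenbauer polynomials are $C^{(\nu)}_n(x)=\frac{(2\nu)_n}{n!}\,{}_2F_1\!\left(-n,\,n+2\nu;\,\nu+\tfrac12;\,\tfrac12(1-x)\right)$. Definition of the weight. For $x\in(-1,1)$ and $m,n\in\{0,\dots,2\ell\}$ with $n\ge m$, $$\bigl(W^{(\nu)}(x)\bigr)_{m,n}=(1-x^2)^{\nu-1/2}\sum_{t=\max(0,n+m-2\ell)}^{m}\alpha^{(\nu)}_t(m,n)\,C^{(\nu)}_{m+n-2t}(x),$$ $$\alpha^{(\nu)}_t(m,n)=(-1)^m\frac{n!\,m!\,(m+n-2t)!}{t!\,(2\nu)_{m+n-2t}\,(\nu)_{n+m-t}}\,\frac{(\nu)_{n-t}(\nu)_{m-t}}{(n-t)!\,(m-t)!}\,\frac{n+m-2t+\nu}{n+m-t+\nu}\,(2\ell-m)!\,(n-2\ell)_{m-t}\,(-2\ell-\nu)_t\,\frac{2\ell+\nu}{(2\ell)!},$$ and $W^{(\nu)}(x)$ is extended to a symmetric matrix. Inner product: $\langle P,Q\rangle^{(\nu)}=\int_{-1}^1P(x)W^{(\nu)}(x)Q(x)^\ast\,dx\in M_{2\ell+1}(\mathbb{C})$. Definition of $\Phi^{(\nu)}$ and $\Psi^{(\nu)}$: $$\Phi^{(\nu)}(x)=\Phi(x)+\frac{(\ell+\nu)^2}{\ell^2}(1-x^2)\mathrm{I},$$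 $$\Phi(x)=x^2\sum_{i=0}^{2\ell}\frac{(\ell-i)^2}{\ell^2}E_{i,i}+x\sum_{i=1}^{2\ell}\frac{(i-1-2\ell)(2\ell-2i+1)}{2\ell^2}E_{i,i-1}+x\sum_{i=0}^{2\ell-1}\frac{(i+1)(2\ell-2i-1)}{2\ell^2}E_{i,i+1}$$ $$\qquad+\sum_{i=2}^{2\ell}\frac{(2\ell-i+2)(2\ell-i+1)}{4\ell^2}E_{i,i-2}+\sum_{i=0}^{2\ell}\frac{-i(2\ell-i+1)-(2\ell-i)(i+1)}{4\ell^2}E_{i,i}+\sum_{i=0}^{2\ell-2}\frac{(i+2)(i+1)}{4\ell^2}E_{i,i+2},$$ $$\frac{-\ell^2}{2\ell+2\nu+1}\Psi^{(\nu)}(x)=x\sum_{i=0}^{2\ell}(\nu+i)(\nu+2\ell-i)E_{i,i}+\frac12\sum_{i=1}^{2\ell}(i-1-2\ell)(\nu+i-1)E_{i,i-1}-\frac12\sum_{i=0}^{2\ell-1}(i+1)(\nu+2\ell-i-1)E_{i,i+1}.$$ *)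

(* Defs.v *)
From mathcomp Require Import all_boot all_order all_algebra.
From mathcomp Require Import all_classical all_reals all_analysis.
From mathcomp Require Import complex.
Import Order.TTheory GRing.Theory Num.Theory.
Import numFieldNormedType.Exports.

Set Implicit Arguments.
Unset Strict Implicit.
Unset Printing Implicit Defensive.

Local Open Scope classical_set_scope.
Local Open Scope ring_scope.
Local Open Scope complex_scope.
Local Open Scope sesquilinear_scope.

Section Gegenbauer.
Context {R : realType}.
Implicit Types (a b c z nu x : R) (n : nat).

Definition pochhammer a n : R := \prod_(k < n) (a + k%:R).

Definition hyp2F1 a b c z : R :=
  limn (series (fun k =>
    pochhammer a k * pochhammer b k / (pochhammer c k * k`!%:R) * z ^+ k)).

Definition gegenbauer nu n x : R :=
  pochhammer (2 * nu) n / n`!%:R *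
  hyp2F1 (- n%:R) (n%:R + 2 * nu) (nu + 2^-1) (2^-1 * (1 - x)).

End Gegenbauer.

(* The half-integer [ell] is encoded by the natural number [N = 2 ell]. *)
Section RealMatrices.
Context {R : realType}.
Variables (N : nat) (nu : R).
Implicit Types (x : R) (m n t i j : nat).

Definition ell : R := N%:R / 2.

(* Meant for [m <= n <= N] and [n + m - N <= t <= m], where every natural
   number subtraction below is exact. *)
Definition alpha t m n : R :=
  (-1) ^+ m
  * ((n`! * m`! * (m + n - 2 * t)`!)%N%:R
     / (t`!%:R * pochhammer (2 * nu) (m + n - 2 * t)
        * pochhammer nu (n + m - t)))
  * (pochhammer nu (n - t) * pochhammer nu (m - t)
     / ((n - t)`! * (m - t)`!)%N%:R)
  * ((n%:R + m%:R - 2 * t%:R + nu) / (n%:R + m%:R - t%:R + nu))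
  * (N - m)`!%:R
  * pochhammer (n%:R - 2 * ell) (m - t)
  * pochhammer (- (2 * ell) - nu) t
  * ((2 * ell + nu) / N`!%:R).

(* The truncated subtraction [n + m - N] is [max(0, n + m - 2 ell)]. *)
Definition weight_entry x m n : R :=
  (1 - x ^+ 2) `^ (nu - 2^-1) *
  \sum_((n + m - N)%N <= t < m.+1) alpha t m n * gegenbauer nu (m + n - 2 * t) x.

Definition weight x : 'M[R]_N.+1 :=
  \matrix_(m, n) weight_entry x (minn m n) (maxn m n).

Definition E i j : 'M[R]_N.+1 := delta_mx (inord i) (inord j).

Definition Phi0 x : 'M[R]_N.+1 :=
  let l := ell in
  x ^+ 2 *: (\sum_(0 <= i < N.+1) ((l - i%:R) ^+ 2 / l ^+ 2) *: E i i)
  + x *: (\sum_(1 <= i < N.+1)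
      ((i%:R - 1 - 2 * l) * (2 * l - 2 * i%:R + 1) / (2 * l ^+ 2))
        *: E i (i - 1))
  + x *: (\sum_(0 <= i < N)
      ((i%:R + 1) * (2 * l - 2 * i%:R - 1) / (2 * l ^+ 2)) *: E i (i + 1))
  + \sum_(2 <= i < N.+1)
      ((2 * l - i%:R + 2) * (2 * l - i%:R + 1) / (4 * l ^+ 2)) *: E i (i - 2)
  + \sum_(0 <= i < N.+1)
      ((- i%:R * (2 * l - i%:R + 1) - (2 * l - i%:R) * (i%:R + 1))
        / (4 * l ^+ 2)) *: E i i
  + \sum_(0 <= i < (N - 1)%N)
      ((i%:R + 2) * (i%:R + 1) / (4 * l ^+ 2)) *: E i (i + 2).

Definition Phi x : 'M[R]_N.+1 :=
  Phi0 x + ((ell + nu) ^+ 2 / ell ^+ 2 * (1 - x ^+ 2))%:M.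

Definition Psi x : 'M[R]_N.+1 :=
  let l := ell in
  (- l ^+ 2 / (2 * l + 2 * nu + 1))^-1 *:
  (x *: (\sum_(0 <= i < N.+1) ((nu + i%:R) * (nu + 2 * l - i%:R)) *: E i i)
   + 2^-1 *: (\sum_(1 <= i < N.+1)
       ((i%:R - 1 - 2 * l) * (nu + i%:R - 1)) *: E i (i - 1))
   - 2^-1 *: (\sum_(0 <= i < N)
       ((i%:R + 1) * (nu + 2 * l - i%:R - 1)) *: E i (i + 1))).

Definition cconst : R :=
  let l := ell in
  (2 * nu + 1) * (2 * l + nu + 1) * l ^+ 2
  / (nu * (2 * nu + 2 * l + 1) * (2 * l + nu) * (l + nu)).

End RealMatrices.

Section ComplexMatrixFunctions.
Context {R : realType}.

(* [f] is of class C^k on [-1, 1]: the derivatives of order at most [k] exist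
   on ]-1, 1[ and extend continuously to [-1, 1].  Only the values of [f] on
   [-1, 1] are constrained. *)
Fixpoint Ck_segment (k : nat) (f : R -> R) : Prop :=
  if k is k'.+1 then
    derivable_oo_LRcontinuous f (-1) 1 /\
    exists g : R -> R, {in `]-1, 1[, derive1 f =1 g} /\ Ck_segment k' g
  else {within `[-1, 1], continuous f}.

Definition Ck_mx (k m n : nat) (P : R -> 'M[R[i]]_(m, n)) : Prop :=
  forall i j, Ck_segment k (fun x => complex.Re (P x i j)) /\
              Ck_segment k (fun x => complex.Im (P x i j)).

Definition deriv_mx (m n : nat) (P : R -> 'M[R[i]]_(m, n)) (x : R) :
    'M[R[i]]_(m, n) :=
  \matrix_(i, j) (derive1 (fun y => complex.Re (P y i j)) x
                  +i* derive1 (fun y => complex.Im (P y i j)) x).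

Definition integral_mx (m n : nat) (P : R -> 'M[R[i]]_(m, n)) :
    'M[R[i]]_(m, n) :=
  \matrix_(i, j)
    ((\int[lebesgue_measure]_(x in `]-1, 1[) complex.Re (P x i j))
     +i* (\int[lebesgue_measure]_(x in `]-1, 1[) complex.Im (P x i j))).

Definition toC_mx (m n : nat) (A : 'M[R]_(m, n)) : 'M[R[i]]_(m, n) :=
  map_mx (real_complex R) A.

Variables (N : nat) (nu : R).
Implicit Types P Q : R -> 'M[R[i]]_N.+1.

Definition inner P Q : 'M[R[i]]_N.+1 :=
  integral_mx (fun x => P x *m toC_mx (weight N nu x) *m (Q x)^t*).

Definition Sop Q (x : R) : 'M[R[i]]_N.+1 :=
  deriv_mx Q x *m (toC_mx (Phi N nu x))^t*
  + Q x *m (toC_mx (Psi N nu x))^t*.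

Definition Dop P (x : R) : 'M[R[i]]_N.+1 :=
  deriv_mx (deriv_mx P) x *m (toC_mx (Phi N nu x))^t*
  + deriv_mx P x *m (toC_mx (Psi N nu x))^t*.

End ComplexMatrixFunctions.

(* Main.v *)
(* Everything follows from the Pearson equations
     W^(nu+1) = c W^(nu) Phi^(nu)   and   (W^(nu+1))' = c W^(nu) Psi^(nu)
   on ]-1, 1[: since W^(nu+1) vanishes at the endpoints, (i) is an integration
   by parts, and (ii) is the Hermitian adjoint of (i) with dP/dx in the role
   of Q.
   For the Pearson equations, let F_k be the Gegenbauer polynomial of degree k
   with F_k(1) = 1.  Up to conjugation by a constant diagonal matrix and a
   scalar, the polynomial part of W^(nu)_(m,n) is
     sum_t (k + nu) g_a g_b w_t w_s F_k,   k = a + b,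
   with a = m - t, b = n - t, s = N - m - n + t, g_a = (nu)_a / a! and
   w_t = binom(nu + N, t).  Moreover Phi^(nu) is the square of a tridiagonal
   matrix plus a multiple of (1 - x^2) I.  The three-term recurrence of the F_k
   and the formulas relating the parameters nu and nu + 1 then reduce both
   equations to polynomial identities in a, b, t, s and nu between the
   coefficients of each F_k. *)

Require Import Defs.
From mathcomp Require Import all_boot all_order all_algebra.
From mathcomp Require Import all_classical all_reals all_analysis.
From mathcomp Require Import measurable_realfun complex ring lra zify.
Import Order.TTheory GRing.Theory Num.Theory.
Import numFieldNormedType.Exports.

Set Implicit Arguments.
Unset Strict Implicit.
Unset Printing Implicit Defensive.

Local Open Scope ring_scope.
Local Open Scope complex_scope.

(** * Gegenbauer polynomials *)

Section Hypergeometric.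
Context {R : realType}.
Implicit Types (a c nu x : R) (n k j : nat).

(** The two sides of a Pearson equation are sums of different lengths, in polynomials of different
    parameters. Lowering nu + 1 to nu uses up a factor 1 - x^2, after which every term is an F_k of
    parameter nu; extending the coefficients by zero lets all sums run over the same t. The
    derivative equation then lives on the degrees m + n + 1 - 2t, the equation for Phi on m + n + 2
    - 2t. Writing Phi0 as a square replaces a five-diagonal computation by two three-term steps, and
    the intermediate coefficients [ucoef] still have a closed form. Inside one coefficient the
    shifted factors are multiples of a common one, which leaves identities in independent variables.
    These factorizations degenerate at small negative indices, hence the case distinctions. In c the
    factor nu / (nu + N) is the quotient of the normalizing constants [wconst] of the two weights;
    the rest comes from [vsum_second_order] and from scaling Phi by N^2. *)

Lemma pochhammer0 a : pochhammer a 0 = 1.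
Proof. by rewrite /pochhammer big_ord0. Qed.

Lemma pochhammerSr a n : pochhammer a n.+1 = pochhammer a n * (a + n%:R).
Proof. by rewrite /pochhammer big_ord_recr. Qed.

Lemma pochhammerS a n : pochhammer a n.+1 = a * pochhammer (a + 1) n.
Proof.
rewrite /pochhammer big_ord_recl addr0; congr (_ * _).
by apply: eq_bigr => i _; rewrite lift0 -natr1; ring.
Qed.

Lemma pochhammer_gt0 a n : 0 < a -> 0 < pochhammer a n.
Proof. by move=> a0; apply: prodr_gt0 => i _; rewrite ltr_wpDr. Qed.

Lemma pochhammer_neq0 a n : 0 < a -> pochhammer a n != 0.
Proof. by move=> a0; rewrite gt_eqF ?pochhammer_gt0. Qed.

Lemma pochhammer_oppn k j : (k < j)%N -> pochhammer (- k%:R : R) j = 0.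
Proof.
move=> kj; rewrite /pochhammer (bigD1 (Ordinal kj)) //=.
by rewrite addNr mul0r.
Qed.

Definition hypc nu k j : R :=
  pochhammer (- k%:R) j * pochhammer (k%:R + 2 * nu) j
  / (pochhammer (nu + 2^-1) j * j`!%:R).

Definition hyppoly nu k : {poly R} := \poly_(j < k.+1) hypc nu k j.

Lemma hypc_eq0 nu k j : (k < j)%N -> hypc nu k j = 0.
Proof. by move=> kj; rewrite /hypc pochhammer_oppn // !mul0r. Qed.

Lemma coef_hyppoly nu k j : (hyppoly nu k)`_j = hypc nu k j.
Proof. by rewrite coef_poly ltnS; case: leqP => // /hypc_eq0 ->. Qed.

Lemma hyp2F1_hyppoly nu k z :
  hyp2F1 (- k%:R) (k%:R + 2 * nu) (nu + 2^-1) z = (hyppoly nu k).[z].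
Proof.
rewrite /hyp2F1; apply/(@lim_near_cst R) => //.
exists k.+1 => //= n kn; rewrite horner_poly /series /=.
rewrite (big_cat_nat (leq0n _) kn) /= [X in _ + X]big1_seq ?addr0 ?big_mkord//.
move=> j /= ; rewrite mem_index_iota => /andP[kj _].
by rewrite -/(hypc nu k j) hypc_eq0 // mul0r.
Qed.

Lemma natr_fact_neq0 n : n`!%:R != 0 :> R.
Proof. by rewrite pnatr_eq0 -lt0n fact_gt0. Qed.

Lemma natr_factS n : n.+1`!%:R = (n%:R + 1) * n`!%:R :> R.
Proof. by rewrite factS natrM -natr1. Qed.

(** This identity and the next two are written in z = (1 - x) / 2, where 1 - 2z = x and 4z (1 - z) =
    1 - x^2. In powers of z they hold coefficient by coefficient, because all Pochhammer symbols
    involved are multiples of common ones. *)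
Lemma hyppoly_three_term nu k : 0 < nu ->
  (2 * (k%:R + nu)) *: ((1 - 2 *: 'X) * hyppoly nu k)
  = (k%:R + 2 * nu) *: hyppoly nu k.+1 + k%:R *: hyppoly nu k.-1.
Proof.
move=> nu0; apply/polyP => j.
rewrite mulrBl mul1r -scalerAl !(coefD, coefZ, coefN, coefXM, coef_hyppoly) /hypc.
case: j => [|j] /=.
  by rewrite !pochhammer0 !fact0; field.
have h1 : pochhammer (nu + 2^-1) j != 0 by apply: pochhammer_neq0; lra.
have h2 := natr_fact_neq0 j.
have h3 : (j%:R : R) + 1 != 0 by rewrite natr1 pnatr_eq0.
have j0 : 0 <= j%:R :> R by rewrite ler0n.
(* The factor k stays in place so that the truncated predecessor at k = 0 does no harm. For k > 0
   one rising factorial of length j + 2 is peeled from both ends. *)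
have E : k%:R * (pochhammer (- k.-1%:R) j.+1 * pochhammer (k.-1%:R + 2 * nu) j.+1)
  = - (pochhammer (- k%:R) j * (- k%:R + j%:R) * (- k%:R + j%:R + 1)
      * ((k%:R - 1 + 2 * nu) * pochhammer (k%:R + 2 * nu) j)) :> R.
  case: k => [|k] /=.
    rewrite mul0r; case: j {h1 h2 h3 j0} => [|j]; first by rewrite pochhammer0; ring.
    by rewrite (@pochhammer_oppn 0) //; ring.
  have <- : pochhammer (- k.+1%:R : R) j.+2
    = pochhammer (- k.+1%:R) j * (- k.+1%:R + j%:R) * (- k.+1%:R + j%:R + 1).
    by rewrite !pochhammerSr -[j.+1%:R]natr1 addrA.
  rewrite [in RHS]pochhammerS [pochhammer (k%:R + _) _]pochhammerS.
  by rewrite -![k.+1%:R]natr1 opprD addrNK -[k%:R + 1 + 2 * nu]addrAC; ring.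
rewrite [X in _ = _ + X]mulrA E.
have E2 : (k%:R + 2 * nu) * (pochhammer (- k.+1%:R) j.+1 * pochhammer (k.+1%:R + 2 * nu) j.+1)
  = (- k%:R - 1) * pochhammer (- k%:R) j
    * (pochhammer (k%:R + 2 * nu) j * (k%:R + 2 * nu + j%:R) * (k%:R + 2 * nu + j%:R + 1)).
  have <- : pochhammer (k%:R + 2 * nu) j.+2
    = pochhammer (k%:R + 2 * nu) j * (k%:R + 2 * nu + j%:R) * (k%:R + 2 * nu + j%:R + 1).
    by rewrite !pochhammerSr -[j.+1%:R]natr1 addrA.
  rewrite [in RHS]pochhammerS [pochhammer (- k.+1%:R) _]pochhammerS.
  by rewrite -![k.+1%:R]natr1 opprD addrNK -[k%:R + 1 + 2 * nu]addrAC; ring.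
rewrite [X in _ = X + _]mulrA E2 !pochhammerSr natr_factS.
field.
by rewrite h1 h2 h3 /= lt0r_neq0 //; lra.
Qed.

Lemma hyppoly_parameter_shift nu k : 0 < nu ->
  (8 * (k%:R + nu + 1)) *: ('X * (1 - 'X) * hyppoly (nu + 1) k)
  = (2 * nu + 1) *: (hyppoly nu k - hyppoly nu k.+2).
Proof.
move=> nu0; apply/polyP => j.
rewrite -mulrA mulrBl mul1r !(coefD, coefZ, coefN, coefXM, coef_hyppoly).
case: j => [|[|j]] /=.
- by rewrite /hypc !pochhammer0; ring.
- rewrite /hypc !pochhammerSr !pochhammer0 -![k.+2%:R]natr1 -![k.+1%:R]natr1.
  by field; rewrite !lt0r_neq0 //; lra.
rewrite /hypc; set p := pochhammer (- k%:R) j.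
have E1 : pochhammer (- k%:R) j.+1 = p * (- k%:R + j%:R) :> R by rewrite pochhammerSr.
have E2 : pochhammer (- k%:R) j.+2 = p * (- k%:R + j%:R) * (- k%:R + j%:R + 1) :> R.
  by rewrite !pochhammerSr -[j.+1%:R]natr1 addrA.
have E3 : pochhammer (- k.+2%:R) j.+2 = (- k%:R - 2) * (- k%:R - 1) * p :> R.
  rewrite !pochhammerS -mulrA -![k.+2%:R]natr1 -![k.+1%:R]natr1 /p.
  congr (_ * (_ * pochhammer _ _)); ring.
set q := pochhammer (k%:R + 2 * (nu + 1)) j.
have F1 : pochhammer (k%:R + 2 * (nu + 1)) j.+1 = q * (k%:R + 2 * (nu + 1) + j%:R).
  by rewrite pochhammerSr.
have F2 : pochhammer (k.+2%:R + 2 * nu) j.+2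
    = q * (k%:R + 2 * (nu + 1) + j%:R) * (k%:R + 2 * (nu + 1) + j%:R + 1).
  rewrite -![k.+2%:R]natr1 -![k.+1%:R]natr1 !pochhammerSr -[j.+1%:R]natr1 /q addrA.
  have -> // : k%:R + 1 + 1 + 2 * nu = k%:R + 2 * (nu + 1) by ring.
have F3 : pochhammer (k%:R + 2 * nu) j.+2 = (k%:R + 2 * nu) * (k%:R + 2 * nu + 1) * q.
  by rewrite !pochhammerS -mulrA /q; congr (_ * (_ * pochhammer _ _)); ring.
set r := pochhammer (nu + 1 + 2^-1) j.
have G1 : pochhammer (nu + 1 + 2^-1) j.+1 = r * (nu + 1 + 2^-1 + j%:R).
  by rewrite pochhammerSr.
have G2 : pochhammer (nu + 2^-1) j.+2 = (nu + 2^-1) * r * (nu + 1 + 2^-1 + j%:R).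
  rewrite pochhammerS pochhammerSr -mulrA /r.
  by have -> // : nu + 2^-1 + 1 = nu + 1 + 2^-1 by ring.
rewrite E1 E2 E3 F1 F2 F3 G1 G2 !natr_factS -[j.+1%:R]natr1.
have j0 : 0 <= j%:R :> R by rewrite ler0n.
have h1 : r != 0 by apply: pochhammer_neq0; lra.
have h2 := natr_fact_neq0 j.
by field; rewrite h1 h2 /=; rewrite !lt0r_neq0 //; lra.
Qed.

Lemma hyppoly_deriv nu k : 0 < nu ->
  2 *: ('X * (1 - 'X) * (hyppoly (nu + 1) k)^`())
  + (2 * nu + 1) *: ((1 - 2 *: 'X) * hyppoly (nu + 1) k)
  = (2 * nu + 1) *: hyppoly nu k.+1.
Proof.
move=> nu0; apply/polyP => j.
rewrite -mulrA [(1 - 'X) * _]mulrBl mulrBl !mul1r -scalerAl.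
rewrite !(coefD, coefZ, coefXM, coefN, coef_deriv, coef_hyppoly).
case: j => [|j] /=; first by rewrite /hypc !pochhammer0 fact0; field.
have E : (if j == 0%N then 0 else hypc (nu + 1) k j.-1.+1 *+ j.-1.+1)
   = j%:R * hypc (nu + 1) k j.
  by case: j => [|j] /=; rewrite ?mul0r ?mulr_natl.
rewrite E -[_ *+ j.+1]mulr_natl /hypc.
have E1 : pochhammer (- k.+1%:R) j.+1 = (- k%:R - 1) * pochhammer (- k%:R) j :> R.
  by rewrite pochhammerS -natr1 opprD addrNK.
have E2 : pochhammer (k.+1%:R + 2 * nu) j.+1
  = (k%:R + 1 + 2 * nu) * pochhammer (k%:R + 2 * (nu + 1)) j.
  by rewrite pochhammerS -natr1; congr (_ * pochhammer _ _); ring.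
have E3 : pochhammer (nu + 2^-1) j.+1 = (nu + 2^-1) * pochhammer (nu + 1 + 2^-1) j.
  by rewrite pochhammerS; congr (_ * pochhammer _ _); ring.
rewrite E1 E2 E3 !pochhammerSr natr_factS -[j.+1%:R]natr1.
have j0 : 0 <= j%:R :> R by rewrite ler0n.
have h1 : pochhammer (nu + 1 + 2^-1) j != 0 by apply: pochhammer_neq0; lra.
have h2 := natr_fact_neq0 j.
by field; rewrite h1 h2 /=; rewrite !lt0r_neq0 //; lra.
Qed.

End Hypergeometric.

Section NormalizedGegenbauer.
Context {R : realType}.
Implicit Types (nu x : R) (k : nat).

(* The normalization [(ngeg nu k).[1] = 1] absorbs the factor [k! / (2 nu)_k]
   of [alpha]. *)
Definition ngeg nu k : {poly R} := hyppoly nu k \Po (2^-1 *: (1 - 'X)).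

Lemma ngegE nu k x : (ngeg nu k).[x] = (hyppoly nu k).[2^-1 * (1 - x)].
Proof. by rewrite horner_comp !hornerE. Qed.

Lemma gegenbauerE nu k x :
  gegenbauer nu k x = pochhammer (2 * nu) k / k`!%:R * (ngeg nu k).[x].
Proof. by rewrite /gegenbauer hyp2F1_hyppoly ngegE. Qed.

Lemma ngeg_three_term nu k x : 0 < nu ->
  2 * (k%:R + nu) * x * (ngeg nu k).[x]
  = (k%:R + 2 * nu) * (ngeg nu k.+1).[x] + k%:R * (ngeg nu k.-1).[x].
Proof.
move=> nu0; have := congr1 (horner^~ (2^-1 * (1 - x))) (hyppoly_three_term k nu0).
by rewrite !hornerE /= !ngegE => <-; field.
Qed.

Lemma ngeg_parameter_shift nu k x : 0 < nu ->
  2 * (k%:R + nu + 1) * (1 - x ^+ 2) * (ngeg (nu + 1) k).[x]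
  = (2 * nu + 1) * ((ngeg nu k).[x] - (ngeg nu k.+2).[x]).
Proof.
move=> nu0; have := congr1 (horner^~ (2^-1 * (1 - x))) (hyppoly_parameter_shift k nu0).
by rewrite !hornerE /= !ngegE => <-; field.
Qed.

(** After multiplication by (1 - x^2)^(nu - 1/2) the left side is the derivative of (1 - x^2)^(nu +
    1/2) F_k, with F_k of parameter nu + 1. This is the source of the equation for the derivative of
    W^(nu+1). *)
Lemma ngeg_deriv nu k x : 0 < nu ->
  (1 - x ^+ 2) * (ngeg (nu + 1) k)^`().[x] - (2 * nu + 1) * x * (ngeg (nu + 1) k).[x]
  = - ((2 * nu + 1) * (ngeg nu k.+1).[x]).
Proof.
move=> nu0; have := congr1 (horner^~ (2^-1 * (1 - x))) (hyppoly_deriv k nu0).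
rewrite deriv_comp derivZ derivB derivC derivX sub0r !hornerE horner_comp !hornerE /=.
by rewrite !ngegE => <-; field.
Qed.

End NormalizedGegenbauer.

(** * Coefficients of the weight *)

Section TwoSidedCoefficients.
Context {R : realType}.
Implicit Types (nu r x : R) (z a b t s m n : int).

(* Both families are extended by zero to negative indices, so that their
   recurrences hold on all of Z and the sums below need no boundary terms. *)
Definition rise nu z : R := if z is Posz k then pochhammer nu k / k`!%:R else 0.

Definition gbin r z : R :=
  if z is Posz k then (\prod_(i < k) (r - i%:R)) / k`!%:R else 0.

Lemma rise_lt0 nu z : z < 0 -> rise nu z = 0.
Proof. by case: z. Qed.

Lemma gbin_lt0 r z : z < 0 -> gbin r z = 0.
Proof. by case: z. Qed.

Lemma rise0 nu : rise nu 0 = 1.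
Proof. by rewrite -[LHS]/(pochhammer nu 0 / 0`!%:R) pochhammer0 fact0 divr1. Qed.

Lemma gbin0 r : gbin r 0 = 1.
Proof. by rewrite -[LHS]/(_ / 0`!%:R) big_ord0 fact0 divr1. Qed.

Lemma riseS nu z : (z%:~R + 1) * rise nu (z + 1) = (nu + z%:~R) * rise nu z.
Proof.
case: z => [k|[|k]].
- have -> : Posz k + 1 = Posz k.+1 by lia.
  rewrite /rise pochhammerSr natr_factS -pmulrn.
  have := natr_fact_neq0 (R := R) k.
  have : 0 <= k%:R :> R by rewrite ler0n.
  by move=> k0 h; field; rewrite h /= lt0r_neq0 //; lra.
- by rewrite /rise mulr0 (_ : Negz 0 = -1) // mulrN1z addNr mul0r.
- by rewrite !rise_lt0 ?mulr0 //; lia.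
Qed.

Lemma gbinS r z : (z%:~R + 1) * gbin r (z + 1) = (r - z%:~R) * gbin r z.
Proof.
case: z => [k|[|k]].
- have -> : Posz k + 1 = Posz k.+1 by lia.
  rewrite /gbin big_ord_recr /= natr_factS -pmulrn.
  have := natr_fact_neq0 (R := R) k.
  have : 0 <= k%:R :> R by rewrite ler0n.
  by move=> k0 h; field; rewrite h /= lt0r_neq0 //; lra.
- by rewrite /gbin mulr0 (_ : Negz 0 = -1) // mulrN1z addNr mul0r.
- by rewrite !gbin_lt0 ?mulr0 //; lia.
Qed.

Lemma rise_succ nu z : nu * rise (nu + 1) z = (nu + z%:~R) * rise nu z.
Proof.
case: z => [k|k]; last by rewrite /rise !mulr0.
by rewrite /rise -pmulrn mulrA -pochhammerS pochhammerSr; ring.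
Qed.

Lemma gbin_succ r z : (r + 1) * gbin r z = (r + 1 - z%:~R) * gbin (r + 1) z.
Proof.
case: z => [k|k]; last by rewrite /gbin !mulr0.
have E : (r + 1) * \prod_(i < k) (r - i%:R)
    = \prod_(i < k) (r + 1 - i%:R) * (r + 1 - k%:R).
  transitivity (\prod_(i < k.+1) (r + 1 - i%:R)); last by rewrite big_ord_recr.
  rewrite big_ord_recl subr0; congr (_ * _).
  by apply: eq_bigr => i _; rewrite lift0 -natr1; ring.
by rewrite /gbin -pmulrn !mulrA E; congr (_ / _); rewrite mulrC.
Qed.

Lemma gbin_pred r z : (r + 1) * gbin r (z - 1) = z%:~R * gbin (r + 1) z.
Proof.
rewrite gbin_succ; have := gbinS (r + 1) (z - 1).
by rewrite subrK rmorphB /= subrK => ->.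
Qed.

(* The disjunction is needed at [nu = 1], where the second case is not an
   instance of the first. *)
Lemma rise_pairP nu a :
  (exists l, rise nu a = l * (a%:~R + 1) /\ rise nu (a + 1) = l * (nu + a%:~R))
  \/ [/\ a%:~R = -1 :> R, rise nu a = 0 & rise nu (a + 1) = 1].
Proof.
have [->|a1] := eqVneq a (-1).
  by right; rewrite addNr rise0 rise_lt0 // mulrN1z.
have h : (a%:~R + 1 : R) != 0.
  by rewrite -[1]/(1%:~R) -rmorphD /= intr_eq0; lia.
left; exists (rise nu a / (a%:~R + 1)); split; first by rewrite divfK.
by apply: (mulfI h); rewrite riseS; field.
Qed.

(** Three values are needed because [ucoef (a + 1)] already reaches a + 2. The exceptional cases
    matter for nu = 1 and nu = 2: there nu + a or nu + a + 1 vanishes although the value of [rise]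
    does not. *)
Lemma rise_tripleP nu a :
  [\/ exists l, [/\ rise nu a = l * ((a%:~R + 1) * (a%:~R + 2)),
        rise nu (a + 1) = l * ((nu + a%:~R) * (a%:~R + 2)) &
        rise nu (a + 1 + 1) = l * ((nu + a%:~R) * (nu + a%:~R + 1))],
    [/\ a%:~R = -2 :> R, rise nu a = 0, rise nu (a + 1) = 0 & rise nu (a + 1 + 1) = 1] |
    [/\ a%:~R = -1 :> R, rise nu a = 0, rise nu (a + 1) = 1 & rise nu (a + 1 + 1) = nu]].
Proof.
have [->|a2] := eqVneq a (-2).
  by apply: Or32; rewrite (_ : -2 + 1 + 1 = 0) // rise0 !rise_lt0 // mulrNz.
have [->|a1] := eqVneq a (-1).
  apply: Or33; rewrite addNr rise_lt0 // rise0; split=> //.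
  by have := riseS nu 0; rewrite rise0 mulr1 add0r addr0 mul1r.
have h1 : (a%:~R + 1 : R) != 0.
  by rewrite -[1]/(1%:~R) -rmorphD /= intr_eq0; lia.
have h2 : (a%:~R + 2 : R) != 0.
  by rewrite -[2]/(2%:~R) -rmorphD /= intr_eq0; lia.
have E1 : rise nu (a + 1) = (nu + a%:~R) * rise nu a / (a%:~R + 1).
  by apply: (mulfI h1); rewrite riseS; field.
have E2 : rise nu (a + 1 + 1) = (nu + a%:~R + 1) * rise nu (a + 1) / (a%:~R + 2).
  apply: (mulfI h2); have := riseS nu (a + 1); rewrite rmorphD /= -!addrA => ->.
  by field.
apply: Or31; exists (rise nu a / ((a%:~R + 1) * (a%:~R + 2))).
by split; rewrite ?E2 ?E1; field; rewrite h1 h2.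
Qed.

Lemma gbin_pairP r z : r + 1 != 0 ->
  exists l, gbin r z = l * (z%:~R + 1) /\ gbin r (z + 1) = l * (r - z%:~R).
Proof.
move=> r1; have [->|z1] := eqVneq z (-1).
  (* At z = -1 the two values are 0 and 1, which forces l (r + 1) = 1. *)
  exists (r + 1)^-1; rewrite mulrN1z addNr mulr0 gbin0 gbin_lt0 //; split=> //.
  by rewrite opprK mulVf.
have h : (z%:~R + 1 : R) != 0.
  by rewrite -[1]/(1%:~R) -rmorphD /= intr_eq0; lia.
exists (gbin r z / (z%:~R + 1)); split; first by rewrite divfK.
by apply: (mulfI h); rewrite gbinS; field.
Qed.

End TwoSidedCoefficients.

(** * Identities between Gegenbauer sums, compared coefficientwise *)

Section GegenbauerSums.
Context {R : realType}.
Variables (N : nat) (nu : R).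
Hypothesis nu_gt0 : 0 < nu.
Implicit Types (mu x : R) (a b t s m n j : int) (c d : int -> R).

(** The upper entry of the binomials for the parameter nu + 1. Both binom(q - 1, t) and binom(q - 1,
    t - 1) are multiples of binom(q, t), so shifted and unshifted summands acquire a common
    factor. *)
Let q : R := nu + N%:R + 1.

Let q_neq0 : q != 0.
Proof. by rewrite lt0r_neq0 // addr_gt0 // ltr_wpDr. Qed.

(* The sums run over [t < N + 3]: for [m <= N] all summands with [t < 0] or
   [t > N + 1] vanish. *)
Definition gsum (F : int -> R) c j : R :=
  \sum_(t < N.+3) c t%:Z * F (j - 2 * t%:Z).

Lemma eq_gsum F c d j : (forall t, c t = d t) -> gsum F c j = gsum F d j.
Proof. by move=> cd; apply: eq_bigr => t _; rewrite cd. Qed.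

Lemma gsumD F c d j :
  gsum F c j + gsum F d j = gsum F (fun t => c t + d t) j.
Proof. by rewrite /gsum -big_split; apply: eq_bigr => t _ /=; rewrite -mulrDl. Qed.

Lemma gsumZ F k c j : k * gsum F c j = gsum F (fun t => k * c t) j.
Proof. by rewrite mulr_sumr; apply: eq_bigr => t _; rewrite mulrA. Qed.

Lemma gsumN F c j : - gsum F c j = gsum F (fun t => - c t) j.
Proof. by rewrite -mulN1r gsumZ; apply: eq_gsum => t; rewrite mulN1r. Qed.

(** The two vanishing conditions account for the slot t = 0 that the reindexing fills and the slot t
    = N + 2 that it drops. *)
Lemma gsum_shift F c j : c (- 1) = 0 -> c N.+2%:Z = 0 ->
  gsum F c (j - 2) = gsum F (fun t => c (t - 1)) j.
Proof.
move=> c0 cN; rewrite /gsum big_ord_recr /= cN mul0r addr0.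
rewrite [RHS]big_ord_recl /= sub0r c0 mul0r add0r.
apply: eq_bigr => t _; rewrite /bump leq0n add1n; congr (c _ * F _); lia.
Qed.

(* The summands are indexed by quadruples with [a + t = m], [b + t = n] and
   [a + b + t + s = N]; shifting [m], [n] or [t] moves such a quadruple by
   unit steps. *)
Definition tup (f : int -> int -> int -> int -> R) m n t : R :=
  f (m - t) (n - t) t (N%:Z - m - n + t).

Lemma tup_shift f m n t : tup f m n (t - 1) =
  tup (fun a b t s => f (a + 1) (b + 1) (t - 1) (s - 1)) m n t.
Proof. by rewrite /tup; congr f; lia. Qed.

Lemma tup_up f m n t : tup f m (n + 1) t =
  tup (fun a b t s => f a (b + 1) t (s - 1)) m n t.
Proof. by rewrite /tup; congr f; lia. Qed.

Lemma tup_down f m n t : tup f m (n - 1) (t - 1) =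
  tup (fun a b t s => f (a + 1) b (t - 1) s) m n t.
Proof. by rewrite /tup; congr f; lia. Qed.

(** Passes from m, n, t to the indices a, b, t, s and keeps, as equations in R, only the two
    relations that the coefficient identities use. *)
Lemma tup_ind (P : int -> int -> int -> Prop) m n t :
  (forall a b s, N%:R = a%:~R + b%:~R + t%:~R + s%:~R :> R ->
     n%:~R = b%:~R + t%:~R :> R -> P a b s) ->
  P (m - t) (n - t) (N%:Z - m - n + t).
Proof.
by apply; rewrite !(rmorphD, rmorphN) /= -?pmulrn; ring.
Qed.

Definition dcoef nu a b t s : R :=
  rise nu a * rise nu b * gbin (nu + N%:R) t * gbin (nu + N%:R) s.

(** The absolute value only makes the function total: negative degrees always come with a zero
    coefficient. *)
Definition Fz nu x z : R := (ngeg nu `|z|%N).[x].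

Definition vcoef nu a b t s : R := (a%:~R + b%:~R + nu) * dcoef nu a b t s.

(* [vsum m n] is the polynomial part of the weight, divided by
   [m! (N - m)! n! (N - n)!] and extended by zero to all integer [n]. *)
Definition vsum mu x m n : R := gsum (Fz mu x) (tup (vcoef mu) m n) (m + n).

Lemma dcoef_lt0 mu a b t s : (a < 0) || (b < 0) || (t < 0) || (s < 0) ->
  dcoef mu a b t s = 0.
Proof.
rewrite /dcoef => /orP[/orP[/orP[]|]|] h.
- by rewrite rise_lt0 // !mul0r.
- by rewrite [rise _ b]rise_lt0 // mulr0 !mul0r.
- by rewrite [gbin _ t]gbin_lt0 // mulr0 mul0r.
- by rewrite [gbin _ s]gbin_lt0 // mulr0.
Qed.

Lemma Fz_three_term x z : 0 <= z ->
  2 * x * ((z%:~R + nu) * Fz nu x z)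
  = (z%:~R + 2 * nu) * Fz nu x (z + 1) + z%:~R * Fz nu x (z - 1).
Proof.
case: z => // k _; have := ngeg_three_term k x nu_gt0.
rewrite /Fz -pmulrn absz_nat (_ : absz (Posz k + 1) = k.+1); last by lia.
case: k => [|k]; first by rewrite !mul0r => <-; ring.
by rewrite (_ : absz (Posz k.+1 - 1) = k) => [<-|]; [ring|lia].
Qed.

(** Multiplication by x sends F_k to the degrees k + 1 and k - 1. Replacing t by t - 1 in the second
    half brings both halves to the degrees m + n + 1 - 2t. *)
Lemma vsumX x m n : (m <= N%:Z) ->
  2 * x * vsum nu x m n
  = gsum (Fz nu x) (tup (fun a b t s => (a%:~R + b%:~R + 2 * nu) * dcoef nu a b t s
      + (a%:~R + b%:~R + 2) * dcoef nu (a + 1) (b + 1) (t - 1) (s - 1)) m n) (m + n + 1).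
Proof.
move=> mN.
set c1 := fun a b t s => (a%:~R + b%:~R + 2 * nu) * dcoef nu a b t s.
set c2 := fun a b t s => (a%:~R + b%:~R) * dcoef nu a b t s.
have -> : 2 * x * vsum nu x m n
    = gsum (Fz nu x) (tup c1 m n) (m + n + 1) + gsum (Fz nu x) (tup c2 m n) (m + n + 1 - 2).
  rewrite /vsum /gsum mulr_sumr -big_split; apply: eq_bigr => t _ /=.
  rewrite /tup /vcoef /c1 /c2.
  set a := m - _; set b := n - _.
  (* Summands with a negative index vanish, so the recurrence is used only at k = a + b >= 0. *)
  have [ab|/negPn/dcoef_lt0 ->] :=
    boolP (~~ ((a < 0) || (b < 0) || (t%:Z < 0) || (N%:Z - m - n + t < 0)));
    last by rewrite !mulr0 !mul0r mulr0 addr0.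
  have -> : m + n + 1 - 2 * t%:Z = a + b + 1 by rewrite /a /b; lia.
  have -> : m + n + 1 - 2 - 2 * t%:Z = a + b - 1 by rewrite /a /b; lia.
  have -> : m + n - 2 * t%:Z = a + b by rewrite /a /b; lia.
  have /Fz_three_term : 0 <= a + b by move: ab; lia.
  move=> /(_ x); rewrite rmorphD /= => h.
  transitivity (dcoef nu a b t%:Z (N%:Z - m - n + t%:Z) *
    (2 * x * ((a%:~R + b%:~R + nu) * Fz nu x (a + b)))); first by ring.
  by rewrite h; ring.
rewrite gsum_shift; first last.
- by rewrite /tup /c2 dcoef_lt0 ?mulr0 //; lia.
- by rewrite /tup /c2 dcoef_lt0 ?mulr0 //; lia.
rewrite gsumD; apply: eq_gsum => t; rewrite tup_shift /tup /c1 /c2.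
by rewrite !(rmorphD, rmorphB) /=; ring.
Qed.

Lemma vsum_up x m n :
  vsum nu x m (n + 1) = gsum (Fz nu x)
    (tup (fun a b t s => vcoef nu a (b + 1) t (s - 1)) m n) (m + n + 1).
Proof. by rewrite /vsum addrA; apply: eq_gsum => t; rewrite tup_up. Qed.

Lemma vsum_down x m n : m <= N%:Z ->
  vsum nu x m (n - 1) = gsum (Fz nu x)
    (tup (fun a b t s => vcoef nu (a + 1) b (t - 1) s) m n) (m + n + 1).
Proof.
move=> mN; rewrite /vsum (_ : m + (n - 1) = m + n + 1 - 2); last by lia.
rewrite gsum_shift; first by apply: eq_gsum => t; rewrite tup_down.
- by rewrite /tup /vcoef dcoef_lt0 ?mulr0 //; lia.
- by rewrite /tup /vcoef dcoef_lt0 ?mulr0 //; lia.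
Qed.

(* Coefficients obtained by applying once the tridiagonal operator whose
   square is [Phi0], see [usumE]; as quadratic forms in [rise] they stay
   regular at [nu = 1], where their factorized form has a pole. *)
Definition ucoef a b t s : R :=
  ((N%:R + 1 + nu) * (a%:~R - b%:~R) * rise nu a * rise nu b
   + (rise nu (a + 1) * rise nu b - rise nu a * rise nu (b + 1)) * t%:~R * s%:~R)
  * gbin (nu + N%:R + 1) t * gbin (nu + N%:R + 1) s.

Definition usum x m n : R :=
  gsum (Fz nu x)
    (tup (fun a b t s => (a%:~R + b%:~R + 1 + nu) * ucoef a b t s) m n) (m + n + 1).

Let gbin_low t : gbin (nu + N%:R) t = (q - t%:~R) * gbin q t / q.
Proof. by apply: (mulfI q_neq0); rewrite gbin_succ [RHS]mulrC divfK. Qed.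

Let gbin_low1 t : gbin (nu + N%:R) (t - 1) = t%:~R * gbin q t / q.
Proof. by apply: (mulfI q_neq0); rewrite gbin_pred [RHS]mulrC divfK. Qed.

(** All three terms on the left expand on the degrees m + n + 1 - 2t. The factor N + 2 nu that comes
    out is one of the two in the (1 - x^2) term of [Phi], since (ell + nu) / ell = (N + 2 nu) /
    N. *)
Lemma usumE x m n : m <= N%:Z ->
  (N%:R - 2 * n%:~R) * x * vsum nu x m n - (n%:~R + 1) * vsum nu x m (n + 1)
  + (N%:R - n%:~R + 1) * vsum nu x m (n - 1)
  = (N%:R + 2 * nu) / (2 * q ^+ 2) * usum x m n.
Proof.
move=> mN; have -> : (N%:R - 2 * n%:~R) * x * vsum nu x m n
  = (N%:R - 2 * n%:~R) / 2 * (2 * x * vsum nu x m n) by field.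
rewrite vsumX // vsum_up vsum_down // /usum !gsumZ gsumN !gsumD.
apply: eq_gsum => t; rewrite /tup.
pattern (m - t), (n - t), (N%:Z - m - n + t); apply: tup_ind => a b s EN ->.
rewrite /vcoef /ucoef /dcoef !gbin_low1 !gbin_low -/q !(rmorphD, rmorphB) /=.
(* Eliminating nu in favour of q, and then N through a + b + t + s, leaves an identity in
   independent variables. *)
have Enu : nu = q - N%:R - 1 by rewrite /q; ring.
move: (gbin q t) (gbin q s) EN => yt ys.
by case: (rise_pairP nu a) => [[la [-> ->]]|[-> -> ->]];
  case: (rise_pairP nu b) => [[lb [-> ->]]|[-> -> ->]];
  move=> EN; rewrite Enu EN; field.
Qed.

(* Coefficients of [4 q^2 (1 - x^2) vsum] on the differences [F_k - F_(k+2)]. *)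
Definition rcoef a b t s : R :=
  (2 * (2 * nu - 1) * rise nu a * rise nu b * (q - t%:~R) * (q - s%:~R)
   + (a%:~R + b%:~R + 1) * ((a%:~R + b%:~R + 2) * q * rise nu a * rise nu b
      - (rise nu a * rise nu (b + 1) + rise nu (a + 1) * rise nu b
         - 2 * rise nu a * rise nu b) * t%:~R * s%:~R)) * gbin q t * gbin q s.

Let Dz x z := Fz nu x z - Fz nu x (z + 2).

(** Two uses of the three-term recurrence expand the left side on the degrees z + 2, z, z - 2. It
    vanishes at x = 1, where every F_k is 1, so the three coefficients add up to 0 and only
    differences remain. *)
Lemma Dz_expansion x z : 0 <= z ->
  4 * (1 - x ^+ 2) * ((z%:~R + nu) * Fz nu x z)
  = (z%:~R + 2 * nu) * (z%:~R + 1 + 2 * nu) / (z%:~R + 1 + nu) * Dz x z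
    - z%:~R * (z%:~R - 1) / (z%:~R - 1 + nu) * Dz x (z - 2).
Proof.
move=> z0; have zR : (0 : R) <= z%:~R by rewrite ler0z.
have E1 := Fz_three_term x z0.
have /(Fz_three_term x) : 0 <= z + 1 by lia.
rewrite (_ : z + 1 + 1 = z + 2) ?addrK; last by lia.
rewrite rmorphD /= => E2.
have h1 : z%:~R + 1 + nu != 0 by rewrite lt0r_neq0 // ltr_wpDl // addr_ge0.
have {}E2 : 2 * x * Fz nu x (z + 1) =
   ((z%:~R + 1 + 2 * nu) * Fz nu x (z + 2) + (z%:~R + 1) * Fz nu x z) / (z%:~R + 1 + nu).
  by rewrite -E2; field.
have -> : 4 * (1 - x ^+ 2) * ((z%:~R + nu) * Fz nu x z)
  = 4 * ((z%:~R + nu) * Fz nu x z) - 2 * x * (2 * x * ((z%:~R + nu) * Fz nu x z)).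
  by ring.
have -> : 2 * x * (2 * x * ((z%:~R + nu) * Fz nu x z))
  = (z%:~R + 2 * nu) * (2 * x * Fz nu x (z + 1)) + z%:~R * (2 * x * Fz nu x (z - 1)).
  by rewrite E1; ring.
rewrite E2 /Dz subrK.
have [->|zn0] := eqVneq z 0.
  by rewrite !mul0r !add0r !subr0; field; rewrite lt0r_neq0 // ltr_wpDl.
have z1 : 1 <= z by lia.
have z1R : (1 : R) <= z%:~R by rewrite ler1z.
have /(Fz_three_term x) : 0 <= z - 1 by lia.
rewrite (_ : z - 1 - 1 = z - 2) ?subrK; last by lia.
rewrite rmorphB /= => E3.
have h3 : z%:~R - 1 + nu != 0 by rewrite lt0r_neq0 // ltr_wpDl // subr_ge0.
have -> : 2 * x * Fz nu x (z - 1) =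
   ((z%:~R - 1 + 2 * nu) * Fz nu x z + (z%:~R - 1) * Fz nu x (z - 2)) / (z%:~R - 1 + nu).
  by rewrite -E3; field.
by field; rewrite h1 h3.
Qed.

(** After the shift of t both parts of [Dz_expansion] have the denominator a + b + 1 + nu. It
    cancels in their sum because a + b + t + s = N, which is why [rcoef] contains no division. *)
Lemma vsum_weighted x m n : m <= N%:Z ->
  4 * q ^+ 2 * (1 - x ^+ 2) * vsum nu x m n = gsum (Dz x) (tup rcoef m n) (m + n).
Proof.
move=> mN.
set e := fun z : R => (z + 2 * nu) * (z + 1 + 2 * nu) / (z + 1 + nu).
set f := fun z : R => z * (z - 1) / (z - 1 + nu).
pose c1 a b t s := e (a%:~R + b%:~R) * dcoef nu a b t s.
pose c2 a b t s := f (a%:~R + b%:~R) * dcoef nu a b t s.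
have -> : 4 * q ^+ 2 * (1 - x ^+ 2) * vsum nu x m n = q ^+ 2 *
    (gsum (Dz x) (tup c1 m n) (m + n) - gsum (Dz x) (tup c2 m n) (m + n - 2)).
  rewrite -mulrA [4 * _]mulrC -mulrA; congr (_ * _).
  rewrite gsumN /vsum /gsum !mulr_sumr -big_split; apply: eq_bigr => t _ /=.
  rewrite /tup /vcoef /c1 /c2.
  set a := m - _; set b := n - _.
  have [ab|/negPn/dcoef_lt0 ->] :=
    boolP (~~ ((a < 0) || (b < 0) || (t%:Z < 0) || (N%:Z - m - n + t < 0)));
    last by rewrite !mulr0 oppr0 !mul0r !mulr0 addr0.
  have -> : m + n - 2 - 2 * t%:Z = a + b - 2 by rewrite /a /b; lia.
  have -> : m + n - 2 * t%:Z = a + b by rewrite /a /b; lia.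
  have /Dz_expansion : 0 <= a + b by move: ab; lia.
  move=> /(_ x); rewrite rmorphD /= => h.
  transitivity (dcoef nu a b t%:Z (N%:Z - m - n + t%:Z) *
    (4 * (1 - x ^+ 2) * ((a%:~R + b%:~R + nu) * Fz nu x (a + b)))); first by ring.
  by rewrite h /e /f; ring.
rewrite gsum_shift; first last.
- by rewrite /tup /c2 dcoef_lt0 ?mulr0 //; lia.
- by rewrite /tup /c2 dcoef_lt0 ?mulr0 //; lia.
rewrite gsumN gsumD gsumZ; apply: eq_gsum => t; rewrite tup_shift /tup /c1 /c2.
pattern (m - t), (n - t), (N%:Z - m - n + t); apply: tup_ind => a b s EN _.
rewrite /dcoef /rcoef !gbin_low1 !gbin_low -/q !(rmorphD, rmorphB) /=.
(* For a + b + 1 < 0 the common denominator may vanish. Only a = b = -1 could contribute, and there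
   f is evaluated at 0 and is 0. *)
have [ab|ab] := leP 0 (a + b + 1); last first.
  have [a1|a1] := ltP a (- 1).
    by rewrite [rise _ a]rise_lt0 ?[rise _ (a + 1)]rise_lt0; [ring|lia|lia].
  have [b1|b1] := ltP b (- 1).
    by rewrite [rise _ b]rise_lt0 ?[rise _ (b + 1)]rise_lt0; [ring|lia|lia].
  have -> : a = -1 by lia.
  have -> : b = -1 by lia.
  by rewrite rise_lt0 // mulrN1z /f; ring.
have {}ab : (0 : R) <= a%:~R + b%:~R + 1 by rewrite -[1]/(1%:~R) -!rmorphD ler0z.
have h : a%:~R + b%:~R + 1 + nu != 0 by rewrite lt0r_neq0 // ltr_wpDl.
rewrite /e /f; move: (gbin q t) (gbin q s) EN h => yt ys.
have -> : a%:~R + 1%:~R + (b%:~R + 1%:~R) - 1 + nu = a%:~R + b%:~R + 1 + nu by ring.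
case: (rise_pairP nu a) => [[la [-> ->]]|[-> -> ->]];
  case: (rise_pairP nu b) => [[lb [-> ->]]|[-> -> ->]];
  move=> EN h;
  rewrite (_ : t%:~R = q - nu - 1 - (N%:R - t%:~R)); try (by rewrite /q; ring);
  rewrite EN; field; rewrite ?q_neq0 ?h //.
Qed.

Definition pcoef a b t s : R :=
  (nu + a%:~R) * (nu + b%:~R) * rise nu a * rise nu b * gbin q t * gbin q s.

Let dcoef_succ a b t s :
  nu ^+ 2 * dcoef (nu + 1) a b t s = pcoef a b t s.
Proof.
rewrite /dcoef /pcoef (_ : nu + 1 + N%:R = q); last by rewrite /q; ring.
have -> : (nu + a%:~R) * (nu + b%:~R) * rise nu a * rise nu b
  = ((nu + a%:~R) * rise nu a) * ((nu + b%:~R) * rise nu b) by ring.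
by rewrite -!rise_succ; ring.
Qed.

Lemma vsum_succ_weighted x m n :
  2 * nu ^+ 2 * (1 - x ^+ 2) * vsum (nu + 1) x m n
  = (2 * nu + 1) * gsum (Dz x) (tup pcoef m n) (m + n).
Proof.
rewrite /vsum /gsum !mulr_sumr; apply: eq_bigr => t _ /=.
rewrite /tup -dcoef_succ /vcoef.
set a := m - _; set b := n - _.
have [ab|/negPn/dcoef_lt0 ->] :=
  boolP (~~ ((a < 0) || (b < 0) || (t%:Z < 0) || (N%:Z - m - n + t < 0)));
  last by rewrite !mulr0 !mul0r !mulr0.
have -> : m + n - 2 * t%:Z = a + b by rewrite /a /b; lia.
have : 0 <= a + b by move: ab; lia.
rewrite -rmorphD /=; case: (a + b) => // k _.
have := ngeg_parameter_shift k x nu_gt0.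
rewrite /Dz /Fz -pmulrn absz_nat (_ : absz (Posz k + 2) = k.+2); last by lia.
move=> h; set D := dcoef _ _ _ _ _.
transitivity (nu ^+ 2 * D * (2 * (k%:R + nu + 1) * (1 - x ^+ 2) * (ngeg (nu + 1) k).[x])).
  by ring.
by rewrite h; ring.
Qed.

Definition dvsum mu x m n : R :=
  gsum (fun z => (ngeg mu `|z|%N)^`().[x]) (tup (vcoef mu) m n) (m + n).

Lemma vsum_succ_deriv x m n :
  nu ^+ 2 * ((1 - x ^+ 2) * dvsum (nu + 1) x m n
    - (2 * nu + 1) * x * vsum (nu + 1) x m n)
  = - ((2 * nu + 1) * gsum (Fz nu x)
       (tup (fun a b t s => (a%:~R + b%:~R + 1 + nu) * pcoef a b t s) m n) (m + n + 1)).
Proof.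
rewrite /dvsum /vsum /gsum !mulr_sumr -sumrB mulr_sumr -sumrN.
apply: eq_bigr => t _ /=.
rewrite /tup -dcoef_succ /vcoef.
set a := m - _; set b := n - _.
have [ab|/negPn/dcoef_lt0 ->] :=
  boolP (~~ ((a < 0) || (b < 0) || (t%:Z < 0) || (N%:Z - m - n + t < 0)));
  last by rewrite !(mulr0, mul0r) subrr mulr0 oppr0.
have -> : m + n + 1 - 2 * t%:Z = a + b + 1 by rewrite /a /b; lia.
have -> : m + n - 2 * t%:Z = a + b by rewrite /a /b; lia.
have : 0 <= a + b by move: ab; lia.
rewrite -rmorphD /=; case: (a + b) => // k _.
have := ngeg_deriv k x nu_gt0.
rewrite /Fz -pmulrn absz_nat (_ : absz (Posz k + 1) = k.+1); last by lia.
move=> h; set D := dcoef _ _ _ _ _.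
transitivity (nu ^+ 2 * (k%:R + (nu + 1)) * D *
  ((1 - x ^+ 2) * (ngeg (nu + 1) k)^`().[x] - (2 * nu + 1) * x * (ngeg (nu + 1) k).[x])).
  by ring.
by rewrite h; ring.
Qed.

(** The Pearson equation for the derivative, for one entry and without the normalizing factors: the
    left side comes from W Psi, the right side from differentiating (1 - x^2)^(nu + 1/2) times
    [vsum (nu + 1)]. *)
Lemma vsum_first_order x m n : m <= N%:Z ->
  2 * q * (2 * nu + 1) * (2 * x * ((nu + n%:~R) * (nu + N%:R - n%:~R)) * vsum nu x m n
    - (n%:~R + 1) * (nu + n%:~R) * vsum nu x m (n + 1)
    - (N%:R - n%:~R + 1) * (nu + N%:R - n%:~R) * vsum nu x m (n - 1))
  = - (2 * nu ^+ 2 * (N%:R + 2 * nu) * ((1 - x ^+ 2) * dvsum (nu + 1) x m n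
    - (2 * nu + 1) * x * vsum (nu + 1) x m n)).
Proof.
move=> mN.
have -> : 2 * nu ^+ 2 * (N%:R + 2 * nu) * ((1 - x ^+ 2) * dvsum (nu + 1) x m n
    - (2 * nu + 1) * x * vsum (nu + 1) x m n)
  = 2 * (N%:R + 2 * nu) * (nu ^+ 2 * ((1 - x ^+ 2) * dvsum (nu + 1) x m n
    - (2 * nu + 1) * x * vsum (nu + 1) x m n)) by ring.
rewrite vsum_succ_deriv.
set S := gsum _ _ _.
have -> : - (2 * (N%:R + 2 * nu) * - ((2 * nu + 1) * S))
  = (2 * q * (2 * nu + 1)) * ((N%:R + 2 * nu) / q * S) by field.
congr (_ * _).
have -> : 2 * x * ((nu + n%:~R) * (nu + N%:R - n%:~R)) * vsum nu x m n
  = ((nu + n%:~R) * (nu + N%:R - n%:~R)) * (2 * x * vsum nu x m n) by ring.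
rewrite vsumX // vsum_up vsum_down // /S !gsumZ !gsumN !gsumD.
apply: eq_gsum => t; rewrite /tup.
pattern (m - t), (n - t), (N%:Z - m - n + t); apply: tup_ind => a b s EN ->.
rewrite /vcoef /pcoef /dcoef !gbin_low1 !gbin_low !(rmorphD, rmorphB) /=.
have Enu : nu = q - N%:R - 1 by rewrite /q; ring.
move: (gbin q t) (gbin q s) EN => yt ys.
by case: (rise_pairP nu a) => [[la [-> ->]]|[-> -> ->]];
  case: (rise_pairP nu b) => [[lb [-> ->]]|[-> -> ->]];
  move=> EN; rewrite Enu EN; field.
Qed.

(** Abel summation: differences of the F_k are traded for differences of the coefficients. *)
Lemma gsumDz x c j : c (- 1) = 0 -> c N.+2%:Z = 0 ->
  gsum (Dz x) c j = gsum (Fz nu x) (fun t => c (t - 1) - c t) (j + 2).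
Proof.
move=> c0 cN.
have -> : gsum (Dz x) c j = gsum (Fz nu x) c (j + 2 - 2) - gsum (Fz nu x) c (j + 2).
  rewrite addrK gsumN /gsum -big_split; apply: eq_bigr => t _ /=.
  by rewrite /Dz (_ : j + 2 - 2 * t%:Z = j - 2 * t%:Z + 2); [ring|lia].
by rewrite gsum_shift // gsumN gsumD.
Qed.

Lemma ucoef_eq0 a b t s : a + b + 1 < 0 -> ucoef a b t s = 0.
Proof.
move=> ab; rewrite /ucoef; have [a1|a1] := ltP a (- 1).
  rewrite (@rise_lt0 _ _ a) ?(@rise_lt0 _ _ (a + 1)); [ring|lia|lia].
have [b1|b1] := ltP b (- 1).
  by rewrite (@rise_lt0 _ _ b) ?(@rise_lt0 _ _ (b + 1)); [ring|lia|lia].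
by rewrite (@rise_lt0 _ _ a) ?(@rise_lt0 _ _ b); [ring|lia|lia].
Qed.

Lemma ucoef_lt0 a b t s : (a < - 1) || (t < 0) -> ucoef a b t s = 0.
Proof.
rewrite /ucoef => /orP[a1|t0]; last by rewrite gbin_lt0 // mulr0 mul0r.
by rewrite (@rise_lt0 _ _ a) ?(@rise_lt0 _ _ (a + 1)); [ring|lia|lia].
Qed.

Lemma rcoef_lt0 a b t s : (a < - 1) || (t < 0) -> rcoef a b t s = 0.
Proof.
rewrite /rcoef => /orP[a1|t0]; last by rewrite gbin_lt0 // mulr0 mul0r.
by rewrite (@rise_lt0 _ _ a) ?(@rise_lt0 _ _ (a + 1)); [ring|lia|lia].
Qed.

Lemma pcoef_lt0 a b t s : (a < - 1) || (t < 0) -> pcoef a b t s = 0.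
Proof.
rewrite /pcoef => /orP[a1|t0]; last by rewrite gbin_lt0 // mulr0 mul0r.
by rewrite (@rise_lt0 _ _ a); [ring|lia].
Qed.

Lemma usumX x m n : m <= N%:Z ->
  2 * x * usum x m n
  = gsum (Fz nu x) (tup (fun a b t s => (a%:~R + b%:~R + 1 + 2 * nu) * ucoef a b t s
      + (a%:~R + b%:~R + 3) * ucoef (a + 1) (b + 1) (t - 1) (s - 1)) m n) (m + n + 2).
Proof.
move=> mN.
pose c1 a b t s := (a%:~R + b%:~R + 1 + 2 * nu) * ucoef a b t s.
pose c2 a b t s := (a%:~R + b%:~R + 1) * ucoef a b t s.
have -> : 2 * x * usum x m n
    = gsum (Fz nu x) (tup c1 m n) (m + n + 2) + gsum (Fz nu x) (tup c2 m n) (m + n + 2 - 2).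
  rewrite /usum /gsum mulr_sumr -big_split; apply: eq_bigr => t _ /=.
  rewrite /tup /c1 /c2.
  set a := m - _; set b := n - _.
  have [ab|/ucoef_eq0 ->] := leP 0 (a + b + 1);
    last by rewrite !(mulr0, mul0r) addr0.
  have -> : m + n + 2 - 2 * t%:Z = a + b + 1 + 1 by rewrite /a /b; lia.
  have -> : m + n + 2 - 2 - 2 * t%:Z = a + b + 1 - 1 by rewrite /a /b; lia.
  have -> : m + n + 1 - 2 * t%:Z = a + b + 1 by rewrite /a /b; lia.
  clearbody a b; have := Fz_three_term x ab; rewrite !rmorphD /= => h.
  transitivity (ucoef a b t%:Z (N%:Z - m - n + t%:Z) *
    (2 * x * ((a%:~R + b%:~R + 1 + nu) * Fz nu x (a + b + 1)))); first by ring.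
  by rewrite h; ring.
rewrite gsum_shift; first last.
- by rewrite /tup /c2 ucoef_lt0 ?mulr0 //; lia.
- by rewrite /tup /c2 ucoef_lt0 ?mulr0 //; lia.
rewrite gsumD; apply: eq_gsum => t; rewrite tup_shift /tup /c1 /c2.
by rewrite !(rmorphD, rmorphB) /=; ring.
Qed.

Lemma usum_up x m n :
  usum x m (n + 1) = gsum (Fz nu x)
    (tup (fun a b t s => (a%:~R + b%:~R + 2 + nu) * ucoef a (b + 1) t (s - 1)) m n) (m + n + 2).
Proof.
rewrite /usum (_ : m + (n + 1) + 1 = m + n + 2); last by lia.
apply: eq_gsum => t; rewrite tup_up /tup !(rmorphD, rmorphB) /=; ring.
Qed.

Lemma usum_down x m n : m <= N%:Z ->
  usum x m (n - 1) = gsum (Fz nu x)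
    (tup (fun a b t s => (a%:~R + b%:~R + 2 + nu) * ucoef (a + 1) b (t - 1) s) m n) (m + n + 2).
Proof.
move=> mN; rewrite /usum (_ : m + (n - 1) + 1 = m + n + 2 - 2); last by lia.
rewrite gsum_shift.
- apply: eq_gsum => t; rewrite tup_down /tup !(rmorphD, rmorphB) /=; ring.
- by rewrite /tup ucoef_lt0 ?mulr0 //; lia.
- by rewrite /tup ucoef_lt0 ?mulr0 //; lia.
Qed.

(** Twice the coefficient of F_(a+b+2) in [vsum_second_order], without the common factor (2 nu + 1)
    q. Only t - 1, t and s - 1, s occur in the binomials, so pairs suffice for them, while [rise]
    needs triples. *)
Let usum_vsum_coef a b t s (k : R) :
  N%:R = a%:~R + b%:~R + t%:~R + s%:~R :> R -> k = b%:~R + t%:~R :> R ->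
  (N%:R - 2 * k) * ((a%:~R + b%:~R + 1 + 2 * nu) * ucoef a b t s
      + (a%:~R + b%:~R + 3) * ucoef (a + 1) (b + 1) (t - 1) (s - 1))
  - 2 * (k + 1) * ((a%:~R + b%:~R + 2 + nu) * ucoef a (b + 1) t (s - 1))
  + 2 * (N%:R - k + 1) * ((a%:~R + b%:~R + 2 + nu) * ucoef (a + 1) b (t - 1) s)
  + (N%:R + 2 * nu) * (rcoef (a + 1) (b + 1) (t - 1) (s - 1) - rcoef a b t s)
  = 4 * q * (2 * nu + N%:R + 1)
    * (pcoef (a + 1) (b + 1) (t - 1) (s - 1) - pcoef a b t s).
Proof.
have q1 : q + 1 != 0 by rewrite lt0r_neq0 // addr_gt0 // addr_gt0 // ltr_wpDr.
have [et] := gbin_pairP (t - 1) q1; rewrite subrK => -[Et1 Et2].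
have [es] := gbin_pairP (s - 1) q1; rewrite subrK => -[Es1 Es2].
rewrite /ucoef /rcoef /pcoef -/q Et1 Et2 Es1 Es2 !(rmorphD, rmorphB) /=.
have Enu : nu = q - N%:R - 1 by rewrite /q; ring.
case: (rise_tripleP nu a) => [[la [-> -> ->]]|[-> -> -> ->]|[-> -> -> ->]];
  case: (rise_tripleP nu b) => [[lb [-> -> ->]]|[-> -> -> ->]|[-> -> -> ->]];
  move=> EN ->; rewrite Enu EN; ring.
Qed.

(** The Pearson equation for Phi, for one entry: a second tridiagonal step applied to [usum], plus
    the (1 - x^2) term. The right side keeps the factor 1 - x^2 by which the weights of parameters
    nu + 1 and nu differ. *)
Lemma vsum_second_order x m n : m <= N%:Z ->
  (2 * nu + 1) * q
  * ((N%:R - 2 * n%:~R) * x * usum x m n - (n%:~R + 1) * usum x m (n + 1)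
     + (N%:R - n%:~R + 1) * usum x m (n - 1)
     + 2 * q ^+ 2 * (N%:R + 2 * nu) * (1 - x ^+ 2) * vsum nu x m n)
  = 4 * q ^+ 2 * (2 * nu + N%:R + 1) * nu ^+ 2 * (1 - x ^+ 2) * vsum (nu + 1) x m n.
Proof.
move=> mN.
have -> : 4 * q ^+ 2 * (2 * nu + N%:R + 1) * nu ^+ 2 * (1 - x ^+ 2) * vsum (nu + 1) x m n
  = 2 * q ^+ 2 * (2 * nu + N%:R + 1)
    * (2 * nu ^+ 2 * (1 - x ^+ 2) * vsum (nu + 1) x m n) by ring.
rewrite vsum_succ_weighted.
have -> : 2 * q ^+ 2 * (N%:R + 2 * nu) * (1 - x ^+ 2) * vsum nu x m n
  = (N%:R + 2 * nu) / 2 * (4 * q ^+ 2 * (1 - x ^+ 2) * vsum nu x m n) by field.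
rewrite vsum_weighted //.
have -> : (N%:R - 2 * n%:~R) * x * usum x m n
  = (N%:R - 2 * n%:~R) / 2 * (2 * x * usum x m n) by field.
rewrite usumX // usum_up usum_down //.
rewrite !gsumDz; first last.
- by rewrite /tup rcoef_lt0 //; lia.
- by rewrite /tup rcoef_lt0 //; lia.
- by rewrite /tup pcoef_lt0 //; lia.
- by rewrite /tup pcoef_lt0 //; lia.
set S := (X in _ = _ * (_ * X)).
have -> : 2 * q ^+ 2 * (2 * nu + N%:R + 1) * ((2 * nu + 1) * S)
  = (2 * nu + 1) * q * (2 * q * (2 * nu + N%:R + 1) * S) by ring.
congr (_ * _); rewrite /S !gsumZ gsumN !gsumD; apply: eq_gsum => t.
rewrite !tup_shift /tup.
pattern (m - t), (n - t), (N%:Z - m - n + t); apply: tup_ind => a b s EN En.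
have E := usum_vsum_coef EN En.
have h2 : (2 : R) != 0 by rewrite pnatr_eq0.
apply: (mulfI h2); rewrite [RHS](_ : _ = 4 * q * (2 * nu + N%:R + 1)
  * (pcoef (a + 1) (b + 1) (t - 1) (s - 1) - pcoef a b t s)); last by ring.
by rewrite -E; field.
Qed.

End GegenbauerSums.

(** * Matrix form and Pearson equations *)

Section WeightMatrix.
Context {R : realType}.
Variables (N : nat) (nu : R).
Hypotheses (N_gt0 : (0 < N)%N) (nu_gt0 : 0 < nu).
Implicit Types (x : R) (m n : nat).

Definition dfac n : R := (n`! * (N - n)`!)%N%:R.

Definition wconst (mu : R) : R := (N`!%:R * pochhammer mu N)^-1.

Lemma pochhammer_opp_add (k s : nat) :
  pochhammer (- (k + s)%:R) k * s`!%:R = (-1) ^+ k * (k + s)`!%:R :> R.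
Proof.
elim: k => [|k IH]; first by rewrite pochhammer0.
rewrite pochhammerS addSn (_ : - (k + s).+1%:R + 1 = - (k + s)%:R); last first.
  by rewrite -natr1; ring.
by rewrite -mulrA IH natr_factS exprS -[(k + s).+1%:R]natr1; ring.
Qed.

Lemma pochhammer_oppB (r : R) (t : nat) :
  pochhammer (- r) t = (-1) ^+ t * \prod_(i < t) (r - i%:R).
Proof.
elim: t => [|t IH]; first by rewrite pochhammer0 big_ord0 mulr1.
by rewrite pochhammerSr IH big_ord_recr /= exprS; ring.
Qed.

Lemma pochhammer_tail mu (k s : nat) :
  pochhammer mu k.+1 * \prod_(i < s) (mu + (k + s)%:R - i%:R) = pochhammer mu (k + s).+1 :> R.
Proof.
elim: s => [|s IH]; first by rewrite big_ord0 mulr1 addn0.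
rewrite addnS [RHS]pochhammerSr -IH big_ord_recl subr0.
rewrite (eq_bigr (fun i : 'I_s => mu + (k + s)%:R - i%:R)); first by ring.
by move=> i _; rewrite lift0 -![_.+1%:R]natr1; ring.
Qed.

(** Uncovers the symmetry between t and s that [alpha] hides. The symbol (n - N)_a is (a + s)! / s!
    up to sign, and dividing (nu)_(N+1) by (nu)_(a+b+t+1) leaves the falling factorial of binom(nu +
    N, s). The three signs multiply to 1. *)
Lemma alphaE (a b t s : nat) : N = (a + b + t + s)%N ->
  alpha N nu t (a + t) (b + t) * (pochhammer (2 * nu) (a + b) / (a + b)`!%:R)
  = wconst nu * dfac (a + t) * dfac (b + t) * vcoef N nu a b t s.
Proof.
move=> EN; rewrite /alpha /vcoef /dcoef /wconst /dfac /rise /gbin /ell.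
have -> : (a + t + (b + t) - 2 * t = a + b)%N by lia.
have -> : (b + t + (a + t) - t = a + b + t)%N by lia.
rewrite !addnK.
have -> : (N - (a + t) = b + s)%N by lia.
have -> : (N - (b + t) = a + s)%N by lia.
have -> : (b + t)%:R - 2 * (N%:R / 2) = - (a + s)%:R :> R.
  by rewrite EN !natrD; field.
have -> : - (2 * (N%:R / 2)) - nu = - (nu + N%:R) by field.
rewrite [pochhammer (- (nu + _)) t]pochhammer_oppB.
have Es := pochhammer_opp_add a s.
have h0 := natr_fact_neq0 (R := R).
have {}Es : pochhammer (- (a + s)%:R) a = (-1) ^+ a * (a + s)`!%:R / s`!%:R :> R.
  by rewrite -Es mulfK.
rewrite Es.
have := pochhammer_tail nu (a + b + t) s.
rewrite -EN !pochhammerSr; set Ps := \prod_(i < s) _; set Pt := \prod_(i < t) _ => ET.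
have p0 k : pochhammer nu k != 0 by apply: pochhammer_neq0.
have p20 k : pochhammer (2 * nu) k != 0 by apply: pochhammer_neq0; rewrite mulr_gt0.
have abt0 k : nu + k%:R != 0 by rewrite lt0r_neq0 // ltr_wpDr.
have {}ET : Ps = pochhammer nu N * (nu + N%:R)
    / (pochhammer nu (a + b + t) * (nu + (a + b + t)%:R)).
  by rewrite -ET mulrC mulKf // mulf_neq0.
rewrite ET -!pmulrn !natrM.
have -> : (b + t)%:R + (a + t)%:R - 2 * t%:R + nu = a%:R + b%:R + nu :> R.
  by rewrite !natrD; ring.
have -> : (b + t)%:R + (a + t)%:R - t%:R + nu = nu + (a + b + t)%:R :> R.
  by rewrite !natrD; ring.
have -> : 2 * (N%:R / 2) + nu = nu + N%:R :> R by field.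
have sgn : (-1) ^+ (a + t) * (-1) ^+ a * (-1) ^+ t = 1 :> R.
  by rewrite -mulrA -exprD -expr2 sqrr_sign.
move: ((-1) ^+ (a + t)) ((-1) ^+ a) ((-1) ^+ t) sgn => e1 e2 e3 sgn.
rewrite -[RHS]mul1r -[X in _ = X * _]sgn.
by field; rewrite ?h0 ?p0 ?p20 -!natrD ?abt0.
Qed.

Lemma vsum_sym x (m n : int) : vsum N nu x m n = vsum N nu x n m.
Proof.
rewrite /vsum [n + m]addrC; apply: eq_gsum => t; rewrite /tup /vcoef /dcoef.
rewrite (_ : N%:Z - n - m + t = N%:Z - m - n + t); last by lia.
by ring.
Qed.

Lemma vsum_out x (m n : int) : (n < 0) || (N%:Z < n) -> vsum N nu x m n = 0.
Proof.
move=> h; rewrite /vsum /gsum big1 // => t _.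
by rewrite /tup /vcoef dcoef_lt0 ?mulr0 ?mul0r //; lia.
Qed.

Lemma weight_entryE x m n : (m <= n)%N -> (n <= N)%N ->
  weight_entry N nu x m n = (1 - x ^+ 2) `^ (nu - 2^-1)
    * (wconst nu * dfac m * dfac n * vsum N nu x m%:Z n%:Z).
Proof.
move=> mn nN; rewrite /weight_entry; congr (_ * _).
rewrite /vsum /gsum -(big_mkord xpredT (fun t : nat =>
  tup N (vcoef N nu) m%:Z n%:Z t%:Z * Fz nu x (m%:Z + n%:Z - 2 * t%:Z))) /=.
have lo : (n + m - N <= m.+1)%N by lia.
have hi : (m.+1 <= N.+3)%N by lia.
(* The range is enlarged to that of [gsum]: below n + m - N the index s is negative, above m the
   index a is. *)
rewrite (big_cat_nat (leq0n _) (leq_trans lo hi)) /= (big_cat_nat lo hi) /=.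
rewrite [X in _ * (X + _)]big1_seq ?add0r; last first.
  move=> t /=; rewrite mem_index_iota => /andP[_ ht].
  by rewrite /tup /vcoef dcoef_lt0 ?mulr0 ?mul0r //; lia.
rewrite [X in _ * (_ + X)]big1_seq ?addr0; last first.
  move=> t /=; rewrite mem_index_iota => /andP[ht _].
  by rewrite /tup /vcoef dcoef_lt0 ?mulr0 ?mul0r //; lia.
rewrite mulr_sumr; apply: eq_big_seq => t; rewrite mem_index_iota => /andP[t1 t2].
rewrite gegenbauerE /tup /Fz.
have Ea : m%:Z - t%:Z = (m - t)%N by lia.
have Eb : n%:Z - t%:Z = (n - t)%N by lia.
have Es : N%:Z - m%:Z - n%:Z + t%:Z = (N + t - m - n)%N by lia.
have Ek : absz (m%:Z + n%:Z - 2 * t%:Z)%R = (m - t + (n - t))%N by lia.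
rewrite Ea Eb Es Ek (_ : (m + n - 2 * t = m - t + (n - t))%N); last by lia.
have EN : N = (m - t + (n - t) + t + (N + t - m - n))%N by lia.
rewrite mulrA [in RHS]mulrA; congr (_ * _).
have tm : (t <= m)%N by lia.
have tn : (t <= n)%N by lia.
by have := alphaE EN; rewrite (subnK tm) (subnK tn) => ->.
Qed.

Lemma weightE x (m n : 'I_N.+1) :
  weight N nu x m n = (1 - x ^+ 2) `^ (nu - 2^-1)
    * (wconst nu * dfac m * dfac n * vsum N nu x (m : nat)%:Z (n : nat)%:Z).
Proof.
rewrite mxE; have [mn|/ltnW nm] := leqP m n.
  by rewrite weight_entryE // -ltnS.
have mN : (m <= N)%N by rewrite -ltnS.
rewrite weight_entryE // [wconst nu * _ * _]mulrAC.
by rewrite (vsum_sym x m n).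
Qed.

Lemma mulmx_sumE (A : 'M[R]_N.+1) lo hi c f (m n : 'I_N.+1) :
  (A *m (\sum_(lo <= i < hi) c i *: E N i (f i))) m n
  = \sum_(lo <= i < hi) c i * (A m (inord i) * (n == inord (f i))%:R).
Proof.
rewrite mulmx_sumr summxE; apply: eq_bigr => i _.
rewrite -scalemxAr mxE; congr (_ * _).
rewrite mxE (bigD1 (inord i)) //= big1 ?addr0; first by rewrite mxE eqxx.
by move=> j /negbTE ji; rewrite mxE ji mulr0.
Qed.

Lemma sum_pick (lo hi j : nat) (F : nat -> R) (p : nat -> bool) :
  (forall i, (lo <= i < hi)%N -> p i = (i == j)) ->
  \sum_(lo <= i < hi) F i * (p i)%:R = if (lo <= j < hi)%N then F j else 0.
Proof.
move=> pj; case: ifPn => jr.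
  rewrite (bigD1_seq j) /=; last 2 first.
  - by rewrite mem_index_iota.
  - exact: iota_uniq.
  rewrite pj // eqxx mulr1 big1_seq ?addr0 // => i /andP[ij].
  by rewrite mem_index_iota => /pj ->; rewrite (negbTE ij) mulr0.
rewrite big1_seq // => i /=; rewrite mem_index_iota => ir.
rewrite pj //; have [ij|_] := eqVneq i j; last by rewrite mulr0.
by rewrite -ij ir in jr.
Qed.

(** * Rows of the weight times the banded matrices *)

Section BandedProducts.
Variables (A : 'M[R]_N.+1) (K : R) (v : int -> R) (m : 'I_N.+1).
Hypothesis A_row : forall n : 'I_N.+1, A m n = K * dfac n * v (n : nat)%:Z.
Hypothesis v_out : forall n : int, (n < 0) || (N%:Z < n) -> v n = 0.
Implicit Types (c : nat -> R) (k : 'I_N.+1).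

Let A_inord i : (i <= N)%N -> A m (inord i) = K * dfac i * v i%:Z.
Proof. by move=> iN; rewrite A_row inordK. Qed.

Let inord_eq k i : (i <= N)%N -> (k == inord i) = (nat_of_ord k == i).
Proof. by move=> iN; rewrite -val_eqE /= inordK. Qed.

Lemma mulmx_diag c k :
  (A *m (\sum_(0 <= i < N.+1) c i *: E N i i)) m k = K * dfac k * (c k * v (k : nat)%:Z).
Proof.
rewrite mulmx_sumE; under eq_bigr do rewrite mulrA.
rewrite (@sum_pick _ _ k); first by rewrite /= ltn_ord inord_val A_row; ring.
by move=> i iN; rewrite inord_eq 1?eq_sym //; lia.
Qed.

Lemma mulmx_sub1 c k :
  (A *m (\sum_(1 <= i < N.+1) c i *: E N i (i - 1))) m k
  = K * dfac k.+1 * (c k.+1 * v ((k : nat)%:Z + 1)).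
Proof.
rewrite mulmx_sumE; under eq_bigr do rewrite mulrA.
rewrite (@sum_pick _ _ k.+1); last first.
  by move=> i iN; rewrite inord_eq; [apply/eqP/eqP|]; lia.
rewrite (_ : (k : nat)%:Z + 1 = k.+1%:Z); last by lia.
case: ifP => kN; first by rewrite A_inord; [ring|lia].
by rewrite v_out ?mulr0 //; lia.
Qed.

Lemma mulmx_sub2 c k :
  (A *m (\sum_(2 <= i < N.+1) c i *: E N i (i - 2))) m k
  = K * dfac k.+2 * (c k.+2 * v ((k : nat)%:Z + 1 + 1)).
Proof.
rewrite mulmx_sumE; under eq_bigr do rewrite mulrA.
rewrite (@sum_pick _ _ k.+2); last first.
  by move=> i iN; rewrite inord_eq; [apply/eqP/eqP|]; lia.
rewrite (_ : (k : nat)%:Z + 1 + 1 = k.+2%:Z); last by lia.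
case: ifP => kN; first by rewrite A_inord; [ring|lia].
by rewrite v_out ?mulr0 //; lia.
Qed.

Lemma mulmx_super1 c k :
  (A *m (\sum_(0 <= i < N) c i *: E N i (i + 1))) m k
  = K * dfac k.-1 * (c k.-1 * v ((k : nat)%:Z - 1)).
Proof.
rewrite mulmx_sumE; under eq_bigr do rewrite mulrA.
have [k0|k0] := posnP k.
  rewrite v_out ?mulr0; last by lia.
  rewrite big1_seq // => i /=; rewrite mem_index_iota => iN.
  rewrite inord_eq; last by lia.
  by rewrite (_ : (_ == _) = false) ?mulr0 //; apply/eqP; lia.
rewrite (@sum_pick _ _ k.-1); last first.
  by move=> i iN; rewrite inord_eq; [apply/eqP/eqP|]; lia.
rewrite (_ : (k : nat)%:Z - 1 = k.-1%:Z); last by lia.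
rewrite ifT; last by have := ltn_ord k; lia.
by rewrite A_inord; [ring|have := ltn_ord k; lia].
Qed.

Lemma mulmx_super2 c k :
  (A *m (\sum_(0 <= i < (N - 1)%N) c i *: E N i (i + 2))) m k
  = K * dfac k.-2 * (c k.-2 * v ((k : nat)%:Z - 1 - 1)).
Proof.
rewrite mulmx_sumE; under eq_bigr do rewrite mulrA.
have [k0|k0] := leqP k 1.
  rewrite v_out ?mulr0; last by lia.
  rewrite big1_seq // => i /=; rewrite mem_index_iota => iN.
  rewrite inord_eq; last by lia.
  by rewrite (_ : (_ == _) = false) ?mulr0 //; apply/eqP; lia.
rewrite (@sum_pick _ _ k.-2); last first.
  by move=> i iN; rewrite inord_eq; [apply/eqP/eqP|]; lia.
rewrite (_ : (k : nat)%:Z - 1 - 1 = k.-2%:Z); last by lia.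
rewrite ifT; last by have := ltn_ord k; lia.
by rewrite A_inord; [ring|have := ltn_ord k; lia].
Qed.

Let dfacS j : (j < N)%N -> dfac j.+1 * (N%:R - j%:R) = (j%:R + 1) * dfac j.
Proof.
move=> jN; rewrite /dfac (_ : N - j = (N - j.+1).+1)%N; last by lia.
rewrite (natrM R j.+1`!) (natrM R j`!) !natr_factS.
rewrite (_ : (N - j.+1)%:R = N%:R - j%:R - 1 :> R); first by ring.
by rewrite natrB // -natr1; ring.
Qed.

(** The factor v extends [dfacS] to j >= N, where the subtraction inside [dfac] is truncated but v
    (j + 1) = 0. *)
Let dfac_up j : dfac j.+1 * (N%:R - j%:R) * v (j%:Z + 1) = (j%:R + 1) * dfac j * v (j%:Z + 1).
Proof.
have [jN|jN] := ltnP j N; first by rewrite dfacS.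
by rewrite v_out ?mulr0 //; lia.
Qed.

Let dfac_up2 j : dfac j.+2 * ((N%:R - j%:R) * (N%:R - j%:R - 1)) * v (j%:Z + 1 + 1)
  = (j%:R + 1) * (j%:R + 2) * dfac j * v (j%:Z + 1 + 1).
Proof.
have [jN|jN] := ltnP j.+1 N; last by rewrite v_out ?mulr0 //; lia.
have E1 := dfacS jN; have E2 := dfacS (ltnW jN); congr (_ * _).
transitivity ((dfac j.+2 * (N%:R - j.+1%:R)) * (N%:R - j%:R)).
  by rewrite -natr1; move: (dfac _) => d; ring.
rewrite E1 -mulrA E2 -natr1; move: (dfac _) => d; ring.
Qed.

Let dfac_down j : (j <= N)%N ->
  dfac j.-1 * j%:R * v (j%:Z - 1) = (N%:R - j%:R + 1) * dfac j * v (j%:Z - 1).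
Proof.
case: j => [|j] /= jN; first by rewrite v_out ?mulr0 //; lia.
by congr (_ * _); rewrite -natr1 mulrC -dfacS //; move: (dfac _) => d; ring.
Qed.

Let dfac_down2 j : (j <= N)%N -> dfac j.-2 * (j%:R * (j%:R - 1)) * v (j%:Z - 1 - 1)
  = (N%:R - j%:R + 1) * (N%:R - j%:R + 2) * dfac j * v (j%:Z - 1 - 1).
Proof.
case: j => [|[|j]] /= jN; [by rewrite v_out ?mulr0 //; lia..|].
have E1 := dfacS jN; have E2 := dfacS (ltnW jN); congr (_ * _).
transitivity ((j.+1%:R + 1) * ((j%:R + 1) * dfac j)).
  by rewrite -!natr1; move: (dfac _) => d; ring.
rewrite -E2 mulrA -E1 -!natr1; move: (dfac _) => d; ring.
Qed.

(* [Phi0] is the square of the tridiagonal matrix with rows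
   [- (N - i + 1) / N], [x (N - 2 i) / N], [(i + 1) / N]; this is [N] times its
   action on a row, after conjugation by [dfac]. *)
Definition bandstep x (u : int -> R) (j : int) : R :=
  (N%:R - 2 * j%:~R) * x * u j - (j%:~R + 1) * u (j + 1) + (N%:R - j%:~R + 1) * u (j - 1).

Let addmxE (B C : 'M[R]_N.+1) i j : (B + C) i j = B i j + C i j.
Proof. by rewrite mxE. Qed.

Let oppmxE (B : 'M[R]_N.+1) i j : (- B) i j = - B i j.
Proof. by rewrite mxE. Qed.

Let scalemxE r (B : 'M[R]_N.+1) i j : (r *: B) i j = r * B i j.
Proof. by rewrite mxE. Qed.

Lemma mulmx_Phi x k :
  N%:R ^+ 2 * (A *m Phi N nu x) m k = K * dfac k
  * (bandstep x (bandstep x v) (k : nat)%:Z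
     + (N%:R + 2 * nu) ^+ 2 * (1 - x ^+ 2) * v (k : nat)%:Z).
Proof.
have N0 : N%:R != 0 :> R by rewrite pnatr_eq0 -lt0n.
rewrite /Phi /Phi0 /ell !mulmxDr -!scalemxAr mul_mx_scalar.
rewrite !(addmxE, scalemxE).
rewrite !mulmx_diag mulmx_sub1 mulmx_super1 mulmx_sub2 mulmx_super2 A_row.
rewrite /bandstep !rmorphD !rmorphN /= -!pmulrn addrK (subrK 1 (k : nat)%:Z).
have kN : (k <= N)%N by rewrite -ltnS.
have E1 := dfac_up k; have E2 := dfac_up2 k.
have E3 := dfac_down kN; have E4 := dfac_down2 kN.
(* At k = 0 the truncated predecessor is wrong as a real number, but the value of v that goes with
   it is 0. *)
have P1 : v ((k : nat)%:Z - 1) = 0 \/ k.-1%:R = k%:R - 1 :> R.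
  case: (nat_of_ord k) => [|j]; first by left; rewrite v_out //; lia.
  by right; rewrite -natr1 addrK.
have P2 : v ((k : nat)%:Z - 1 - 1) = 0 \/ k.-2%:R = k%:R - 2 :> R.
  case: (nat_of_ord k) => [|[|j]]; [by left; rewrite v_out //; lia..|].
  by right; rewrite -!natr1; ring.
have S1 : k.+1%:R = k%:R + 1 :> R by rewrite natr1.
have S2 : k.+2%:R = k%:R + 2 :> R by rewrite -!natr1; ring.
move: E1 E2 E3 E4 P1 P2 S1 S2.
move: (v (k : nat)%:Z) (v ((k : nat)%:Z + 1)) (v ((k : nat)%:Z - 1)) => v0 v1 w1.
move: (v ((k : nat)%:Z + 1 + 1)) (v ((k : nat)%:Z - 1 - 1)) => v2 w2.
move: (dfac k) (dfac k.+1) (dfac k.-1) (dfac k.+2) (dfac k.-2) => d d1 c1 d2 c2.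
move: k.+1%:R k.-1%:R k.+2%:R k.-2%:R k%:R => k1 j1 k2 j2 k0.
move=> E1 E2 E3 E4 P1 P2 -> ->.
(* Regrouped so that each shifted [dfac] stands next to the factor that E1, E2, E3 or E4 turns into
   a multiple of d. *)
rewrite [LHS](_ : _ = K * (x ^+ 2 * (N%:R - 2 * k0) ^+ 2 * d * v0
  - 2 * x * (N%:R - 2 * k0 - 1) * (d1 * (N%:R - k0) * v1)
  + 2 * x * (N%:R - 2 * k0 + 1) * (c1 * k0 * w1)
  + d2 * ((N%:R - k0) * (N%:R - k0 - 1)) * v2
  + (- k0 * (N%:R - k0 + 1) - (N%:R - k0) * (k0 + 1)) * d * v0
  + c2 * (k0 * (k0 - 1)) * w2
  + (N%:R + 2 * nu) ^+ 2 * (1 - x ^+ 2) * d * v0)).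
  by rewrite E1 E2 E3 E4; ring.
by case: P1 => ->; case: P2 => ->; field.
Qed.

Lemma mulmx_Psi x k :
  N%:R ^+ 2 * (A *m Psi N nu x) m k = - (2 * (N%:R + 2 * nu + 1)) * K * dfac k
  * (2 * x * ((nu + k%:R) * (nu + N%:R - k%:R)) * v (k : nat)%:Z
     - (k%:R + 1) * (nu + k%:R) * v ((k : nat)%:Z + 1)
     - (N%:R - k%:R + 1) * (nu + N%:R - k%:R) * v ((k : nat)%:Z - 1)).
Proof.
have N0 : N%:R != 0 :> R by rewrite pnatr_eq0 -lt0n.
have Nnu : N%:R + 2 * nu + 1 != 0.
  by rewrite lt0r_neq0 // addr_gt0 // ltr_wpDl // mulr_gt0.
rewrite /Psi /ell -scalemxAr mulmxBr mulmxDr -!scalemxAr.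
rewrite !(addmxE, scalemxE, oppmxE).
rewrite !mulmx_diag mulmx_sub1 mulmx_super1.
have kN : (k <= N)%N by rewrite -ltnS.
have E1 := dfac_up k; have E3 := dfac_down kN.
have P1 : v ((k : nat)%:Z - 1) = 0 \/ k.-1%:R = k%:R - 1 :> R.
  case: (nat_of_ord k) => [|j]; first by left; rewrite v_out //; lia.
  by right; rewrite -natr1 addrK.
have S1 : k.+1%:R = k%:R + 1 :> R by rewrite natr1.
move: E1 E3 P1 S1.
move: (v (k : nat)%:Z) (v ((k : nat)%:Z + 1)) (v ((k : nat)%:Z - 1)) => v0 v1 w1.
move: (dfac k) (dfac k.+1) (dfac k.-1) => d d1 c1.
move: k.+1%:R k.-1%:R k%:R => k1 j1 k0.
move=> E1 E3 P1 ->.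
rewrite [LHS](_ : _ = - (2 * (N%:R + 2 * nu + 1)) * K *
  (2 * x * ((nu + k0) * (nu + N%:R - k0)) * d * v0
   - (nu + k0) * (d1 * (N%:R - k0) * v1)
   - (nu + N%:R - k0) * (c1 * k0 * w1))).
  by rewrite E1 E3; ring.
by case: P1 => ->; field; rewrite Nnu N0.
Qed.

End BandedProducts.

End WeightMatrix.

Lemma le_ordz N (m : 'I_N.+1) : (m : nat)%:Z <= N%:Z.
Proof. by rewrite lez_nat -ltnS. Qed.

(** * The Pearson equations for the weight matrix *)

Section Pearson.
Context {R : realType}.
Variables (N : nat) (nu : R).
Hypotheses (N_gt0 : (0 < N)%N) (nu_gt0 : 0 < nu).
Implicit Types (x : R) (m n : 'I_N.+1).

Lemma wconst_succ : (nu + N%:R) * wconst N (nu + 1) = nu * wconst N nu.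
Proof.
have E : nu * pochhammer (nu + 1) N = pochhammer nu N * (nu + N%:R).
  by rewrite -pochhammerS pochhammerSr.
have h0 := natr_fact_neq0 (R := R) N.
have h1 := pochhammer_neq0 N nu_gt0.
have h2 : pochhammer (nu + 1) N != 0 by apply: pochhammer_neq0; rewrite addr_gt0.
rewrite /wconst; apply: (mulfI h2); apply: (mulfI h1).
transitivity (pochhammer nu N * (nu + N%:R) / N`!%:R); first by field; rewrite ?h0 ?h1 ?h2.
by rewrite -E; field; rewrite ?h0 ?h1 ?h2.
Qed.

Let N0 : N%:R != 0 :> R. Proof. by rewrite pnatr_eq0 -lt0n. Qed.
Let nu1 : nu != 0. Proof. by rewrite lt0r_neq0. Qed.
Let nuN : nu + N%:R != 0. Proof. by rewrite lt0r_neq0 // ltr_wpDr. Qed.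
Let nuN1 : nu + N%:R + 1 != 0. Proof. by rewrite lt0r_neq0 // addr_gt0 // ltr_wpDr. Qed.
Let nu2 : 2 * nu + 1 != 0. Proof. by rewrite lt0r_neq0 // addr_gt0 // mulr_gt0. Qed.
Let nu2N : N%:R + 2 * nu != 0. Proof. by rewrite lt0r_neq0 // ltr_wpDl // mulr_gt0. Qed.
Let nu2N1 : N%:R + 2 * nu + 1 != 0.
Proof. by rewrite lt0r_neq0 // addr_gt0 // ltr_wpDl // mulr_gt0. Qed.

Lemma cconstE : cconst N nu =
  (2 * nu + 1) * (nu + N%:R + 1) * N%:R ^+ 2
  / (2 * nu * (N%:R + 2 * nu + 1) * (nu + N%:R) * (N%:R + 2 * nu)).
Proof.
by rewrite /cconst /ell; field; rewrite nu1 nuN nu2N nu2N1.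
Qed.

Lemma cconst_neq0 : cconst N nu != 0.
Proof.
by rewrite cconstE !mulf_neq0 ?invr_eq0 ?expf_neq0 ?mulf_neq0 // pnatr_eq0.
Qed.

Lemma one_sub_sqr_gt0 x : -1 < x < 1 -> 0 < 1 - x ^+ 2.
Proof.
move=> /andP[x1 x2]; rewrite (_ : 1 - x ^+ 2 = (1 - x) * (1 + x)); last by ring.
by rewrite mulr_gt0 ?subr_gt0 // -ltrBlDl sub0r.
Qed.

Let powR_succ x : -1 < x < 1 ->
  (1 - x ^+ 2) `^ (nu + 1 - 2^-1) = (1 - x ^+ 2) * (1 - x ^+ 2) `^ (nu - 2^-1).
Proof.
move=> /one_sub_sqr_gt0 h; rewrite (_ : nu + 1 - 2^-1 = 1 + (nu - 2^-1)); last by ring.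
have hx := lt0r_neq0 h.
by rewrite (@powRD _ _ 1) ?hx ?implybT // powRr1 // ltW.
Qed.

Let weight_row x m n : weight N nu x m n
  = (1 - x ^+ 2) `^ (nu - 2^-1) * (wconst N nu * dfac N m) * dfac N n
    * vsum N nu x (m : nat)%:Z (n : nat)%:Z.
Proof. by rewrite weightE // !mulrA. Qed.

Let vsum_row_out x (m : 'I_N.+1) (n : int) :
  (n < 0) || (N%:Z < n) -> vsum N nu x (m : nat)%:Z n = 0.
Proof. exact: vsum_out. Qed.

Lemma bandstep_vsum x m (j : int) :
  bandstep N x (vsum N nu x (m : nat)%:Z) j
  = (N%:R + 2 * nu) / (2 * (nu + N%:R + 1) ^+ 2) * usum N nu x (m : nat)%:Z j.
Proof. by apply: usumE => //; exact: le_ordz. Qed.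

Lemma weight_succE x m n : -1 < x < 1 ->
  weight N (nu + 1) x m n = (1 - x ^+ 2) `^ (nu - 2^-1)
    * (wconst N (nu + 1) * dfac N m * dfac N n)
    * ((1 - x ^+ 2) * vsum N (nu + 1) x (m : nat)%:Z (n : nat)%:Z).
Proof.
move=> x11; rewrite weightE // ?addr_gt0 // powR_succ //.
by move: (_ `^ _) (wconst _ _) (dfac _ m) (dfac _ n) (vsum _ _ _ _ _) => a b c d e; ring.
Qed.

Lemma weight_Pearson x : -1 < x < 1 ->
  weight N (nu + 1) x = cconst N nu *: (weight N nu x *m Phi N nu x).
Proof.
move=> x11; apply/matrixP => m n; rewrite weight_succE // mxE.
have mN := le_ordz m.
have h2 : N%:R ^+ 2 != 0 :> R by rewrite expf_neq0.
have := mulmx_Phi N_gt0 nu_gt0 (weight_row x m) (vsum_row_out x m) x n.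
(* Only the outer step is unfolded; the inner ones become [usum], which gives the left side of
   [vsum_second_order]. *)
rewrite {1}/bandstep !bandstep_vsum => E.
have := vsum_second_order nu_gt0 x (n : nat)%:Z mN; move: E.
rewrite -!pmulrn; move: ((_ *m _) m n) => P.
move: (usum _ _ _ _ _) (usum _ _ _ _ _) (usum _ _ _ _ _) => u1 u2 u3.
move: (vsum _ nu _ _ _) (vsum _ (nu + 1) _ _ _) => v v'.
have Ew : wconst N (nu + 1) = nu * wconst N nu / (nu + N%:R).
  by rewrite -wconst_succ; field.
rewrite Ew; move: (dfac _ m) (dfac _ n) (wconst N nu) (_ `^ _) => d1 d2 w p.
set q := nu + N%:R + 1 => E1.
set S := (_ * x * u3 - _ + _ + _) => E2.
have ES : S = 4 * q ^+ 2 * (2 * nu + N%:R + 1) * nu ^+ 2 * (1 - x ^+ 2) * v'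
    / ((2 * nu + 1) * q).
  by rewrite -E2; field; rewrite nu2 nuN1.
have EP : P = p * (w * d1) * d2 * ((N%:R + 2 * nu) / (2 * q ^+ 2)) * S / N%:R ^+ 2.
  by apply: (mulfI h2); rewrite E1 /S; field; rewrite nuN1 N0.
rewrite EP ES cconstE /q; field.
by rewrite nu1 nuN nuN1 nu2 nu2N nu2N1 N0.
Qed.

(** Justifies [dvsum] as a derivative and reduces the analysis of the weight to powers of 1 - x^2
    times polynomials. *)
Lemma vsum_poly mu (m n : int) : exists p : {poly R},
  (forall x, vsum N mu x m n = p.[x]) /\ (forall x, dvsum N mu x m n = p^`().[x]).
Proof.
exists (\sum_(t < N.+3) tup N (vcoef N mu) m n t%:Z *: ngeg mu (absz (m + n - 2 * t%:Z)%R)).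
split=> x; rewrite ?raddf_sum horner_sum; apply: eq_bigr => t _; first by rewrite hornerZ.
by rewrite /= derivZ hornerZ.
Qed.

Lemma is_derive_weight x m n : -1 < x < 1 ->
  is_derive x (1 : R) (fun y => weight N (nu + 1) y m n)
    (cconst N nu * (weight N nu x *m Psi N nu x) m n).
Proof.
move=> x11; have x0 := one_sub_sqr_gt0 x11.
have [p [Ep Ep']] := vsum_poly (nu + 1) (m : nat)%:Z (n : nat)%:Z.
have Ew : wconst N (nu + 1) = nu * wconst N nu / (nu + N%:R).
  by rewrite -wconst_succ; field.
set C := wconst N (nu + 1) * dfac N m * dfac N n.
have -> : (fun y => weight N (nu + 1) y m n)
    = (fun y => (1 - y ^+ 2) `^ (nu + 1 - 2^-1)) * (fun y => C * p.[y]).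
  by apply/funext => y; rewrite weightE ?addr_gt0 // Ep.
have d1 : is_derive x (1 : R) (fun y => (1 - y ^+ 2) `^ (nu + 1 - 2^-1))
    ((nu + 2^-1) * (1 - x ^+ 2) `^ (nu - 2^-1) * (- (2 * x))).
  have dpow := is_derive1_powR (nu + 1 - 2^-1) x0.
  have dsq : is_derive x (1 : R) (fun y : R => 1 - y ^+ 2) (- (2 * x)).
    have -> : (fun y : R => 1 - y ^+ 2) = horner (1 - 'X^2).
      by apply/funext => y; rewrite !hornerE.
    apply: (trigger_derive (is_derive_poly (1 - 'X^2) x)).
    by rewrite derivB derivXn derivC sub0r !hornerE /=; ring.
  have dd := @is_derive1_comp _ (fun z : R => z `^ (nu + 1 - 2^-1))
    (fun y : R => 1 - y ^+ 2) x _ _ dpow dsq.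
  apply: (trigger_derive dd).
  have e1 : nu + 1 - 2^-1 - 1 = nu - 2^-1 by ring.
  have e2 : nu + 1 - 2^-1 = nu + 2^-1 by field.
  by rewrite e1 e2.

have d2 : is_derive x (1 : R) (fun y => C * p.[y]) (C * p^`().[x]).
  have -> : (fun y => C * p.[y]) = horner (C *: p) by apply/funext => y; rewrite hornerZ.
  by apply: (trigger_derive (is_derive_poly (C *: p) x)); rewrite derivZ hornerZ.
apply: (trigger_derive (is_deriveM d1 d2)).
(* Splitting off one factor 1 - x^2 gives both terms of the product rule the power nu - 1/2; what
   remains is the bracket in [vsum_first_order]. *)
rewrite powR_succ // /GRing.scale /= -Ep -Ep' /C.
have mN := le_ordz m.
have h2 : N%:R ^+ 2 != 0 :> R by rewrite expf_neq0.
have := mulmx_Psi N_gt0 nu_gt0 (weight_row x m) (vsum_row_out x m) x n.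
have := vsum_first_order nu_gt0 x (n : nat)%:Z mN.
rewrite -!pmulrn; move: ((_ *m _) m n) => P.
move: (vsum _ nu _ _ _) (vsum _ nu _ _ _) (vsum _ nu _ _ _) => v1 v2 v3.
move: (vsum _ (nu + 1) _ _ _) (dvsum _ (nu + 1) _ _ _) => v v'.
rewrite Ew; move: (dfac _ m) (dfac _ n) (wconst N nu) (_ `^ _) => e1 e2 w r.
set q := nu + N%:R + 1; set Z := _ - _ - _ => E2 E1.
have EZ : Z = - (2 * nu ^+ 2 * (N%:R + 2 * nu)
    * ((1 - x ^+ 2) * v' - (2 * nu + 1) * x * v)) / (2 * q * (2 * nu + 1)).
  by rewrite -E2; field; rewrite nu2 nuN1.
have EP : P = - (2 * (N%:R + 2 * nu + 1)) * (r * (w * e1)) * e2 * Z / N%:R ^+ 2.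
  by apply: (mulfI h2); rewrite E1; field; rewrite N0.
rewrite EP EZ cconstE /q; field.
by rewrite nu1 nuN nuN1 nu2 nu2N nu2N1 N0.
Qed.

End Pearson.

(** * Integration on an open interval *)

Local Open Scope classical_set_scope.
Local Open Scope ring_scope.

(* For [nu < 1/2] the integrands are unbounded near the endpoints, so the
   fundamental theorem is needed for integrable derivatives on an open interval. *)
Section OpenIntervalFTC.
Context {R : realType}.
Let mu := @lebesgue_measure R.
Implicit Types (a b : R) (f F : R -> R).

(** The indefinite integral G of f, extended by zero, is continuous on the closed interval by
    integrability alone. G - F has derivative 0 inside, so the mean value theorem equates its
    endpoint values. *)
Lemma Rintegral_derivative_oo a b F f : a < b ->
  derivable_oo_LRcontinuous F a b ->
  {in `]a, b[, forall x, is_derive x (1 : R) F (f x)} ->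
  {in `]a, b[, forall x, {for x, continuous f}} ->
  mu.-integrable `]a, b[ (EFin \o f) ->
  \int[mu]_(x in `]a, b[) f x = F b - F a.
Proof.
move=> ab cF dF cf intf.
set f0 := f \_ `]a, b[.
have ifab : mu.-integrable `[a, b] (EFin \o f0).
  rewrite -restrict_EFin; apply/integrable_restrict => //.
  by rewrite setIidr //; exact: subset_itv_oo_cc.
pose G x := \int[mu]_(t in `[a, x]) f0 t.
have cG : {within `[a, b], continuous G}.
  exact: (parameterized_integral_continuous (ltW ab) ifab).
have dG x : x \in `]a, b[ -> is_derive x (1 : R) G (f x).
  move=> xab; have fx : f0 x = f x by rewrite /f0 patchE ifT // inE.
  have cf0 : {for x, continuous f0}.
    have nf : \near x, f x = f0 x.
      near=> y; rewrite /f0 patchE ifT // inE /=.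
      by near: y; exact: near_in_itvoo.
    rewrite /prop_for /continuous_at fx.
    by apply: cvg_trans (cf _ xab); apply: near_eq_cvg.
  move: (xab); rewrite in_itv /= => /andP[ax xb].
  have [dGx] := continuous_FTC1_closed xb ifab ax cf0.
  by rewrite derive1E fx => E; apply: DeriveDef.
have dH x : x \in `]a, b[ -> is_derive x (1 : R) (G - F) (cst 0 x).
  move=> xab; have := is_deriveB (dG x xab) (dF x xab).
  by rewrite subrr.
have cH : {within `[a, b], continuous (G - F)}.
  move=> x; apply: cvgB; first exact: cG.
  exact: (derivable_oo_LRcontinuous_within cF).
have [c _ E] := MVT ab dH cH.
have {}E : G b - F b = G a - F a.
  by move: E; rewrite mul0r => /eqP; rewrite subr_eq0 => /eqP.
have Ga : G a = 0 by rewrite /G set_itv1 Rintegral_set1.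
have Gb : G b = \int[mu]_(x in `]a, b[) f x.
  by rewrite /G -Rintegral_mkcondr setIidr //; exact: subset_itv_oo_cc.
by rewrite -Gb -(subrK (F b) (G b)) E Ga sub0r addrC.
Unshelve. all: by end_near. Qed.

(** On closed intervals exhausting the open one, the integral of f is a difference of values of F,
    at most F b - F a because F is nondecreasing. Monotone convergence carries the bound to the
    limit. *)
Lemma integrable_ge0_derivative_oo a b F f : a < b ->
  derivable_oo_LRcontinuous F a b ->
  {in `]a, b[, forall x, is_derive x (1 : R) F (f x)} ->
  {in `]a, b[, forall x, {for x, continuous f}} ->
  {in `]a, b[, forall x, 0 <= f x} ->
  mu.-integrable `]a, b[ (EFin \o f).
Proof.
move=> ab cF dF cf f0.
have mf : measurable_fun `]a, b[ f.
  apply: open_continuous_measurable_fun => //.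
  by move=> x; rewrite inE => xab; exact: cf.
have Fm : {in `[a, b] &, {homo F : x y / x <= y}}.
  apply: ger0_derive1_le_cc; last exact: derivable_oo_LRcontinuous_within.
    by move=> x xab; have [] := dF x xab.
  by move=> x xab; have [_ E] := dF x xab; rewrite derive1E E f0.
pose I n : set R := `[a + n.+1%:R^-1, b - n.+1%:R^-1]%classic.
have Isub n : I n `<=` `]a, b[%classic.
  move=> x; rewrite /I /= !in_itv /= => /andP[x1 x2]; apply/andP; split.
    by apply: lt_le_trans x1; rewrite ltrDl invr_gt0.
  by apply: le_lt_trans x2 _; rewrite ltrBlDr ltrDl invr_gt0.
have mI n : measurable (I n) by exact: measurable_itv.
have Icup : \bigcup_n I n = `]a, b[%classic.
  apply/seteqP; split => [x [n _]|x]; first exact: Isub.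
  rewrite /= in_itv /= => /andP[ax xb].
  pose e := Num.min (x - a) (b - x).
  have e0 : 0 < e by rewrite /e lt_min !subr_gt0 ax.
  exists (Num.truncn e^-1) => //; rewrite /I /= in_itv /=.
  have : (Num.truncn e^-1).+1%:R^-1 <= e.
    by rewrite -[leRHS]invrK lef_pV2 ?posrE ?invr_gt0 ?ltr0n // ltW // truncnS_gt.
  rewrite /e le_min lerBrDr addrC => /andP[-> /=].
  by rewrite !lerBrDr addrC.
have Imono : nondecreasing_seq I.
  move=> m n mn; apply/subsetPset => x; rewrite /I /= !in_itv /= => /andP[x1 x2].
  have h : n.+1%:R^-1 <= m.+1%:R^-1 :> R by rewrite lef_pV2 ?posrE ?ltr0n // ler_nat.
  by rewrite (le_trans _ x1) ?lerD2l // (le_trans x2) // lerD2l lerN2.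
have mEf : measurable_fun `]a, b[ (EFin \o f) by exact/measurable_EFinP.
have Ef0 n x : I n x -> (0 <= (f x)%:E)%E.
  by move=> /Isub xab; rewrite lee_fin f0.
have bound n : (\int[mu]_(x in I n) (f x)%:E <= (F b - F a)%:E)%E.
  have Fab : 0 <= F b - F a.
    by rewrite subr_ge0 Fm ?in_itv /= ?lexx ?ltW.
  (* For small n the interval may be a point or empty. *)
  have [ltI|] := ltP (a + n.+1%:R^-1) (b - n.+1%:R^-1); last first.
    rewrite le_eqVlt => /predU1P[eqI|gtI]; rewrite /I.
      by rewrite eqI set_itv1 integral_set1 lee_fin.
    by rewrite set_itv_ge ?integral_set0 ?lee_fin // bnd_simp -ltNge.
  have Isub' : `[a + n.+1%:R^-1, b - n.+1%:R^-1] `<=` `[a, b].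
    by move=> x /Isub /=; exact: subset_itv_oo_cc.
  have Ioo : `]a + n.+1%:R^-1, b - n.+1%:R^-1[ `<=` `]a, b[.
    by move=> x /subset_itv_oo_cc /Isub.
  have e0 : 0 < n.+1%:R^-1 :> R by rewrite invr_gt0.
  have ae : a < a + n.+1%:R^-1 by rewrite ltrDl.
  have be : b - n.+1%:R^-1 < b by rewrite ltrBlDr ltrDl.
  have aI : a + n.+1%:R^-1 \in `[a, b].
    by rewrite in_itv /= ltW //= ltW // (lt_trans ltI).
  have bI : b - n.+1%:R^-1 \in `[a, b].
    by rewrite in_itv /= [X in _ && X]ltW // andbT ltW // (lt_trans ae).
  rewrite /I (@continuous_FTC2 _ _ F) //.
  - by rewrite -EFinB lee_fin lerB // Fm ?bound_itvE ?ltW.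
  - apply: continuous_in_subspaceT => x; rewrite inE => /Isub; exact: cf.
  - exact: (derivable_oo_continuousW ltI Isub' cF).
  - by move=> x /Ioo xab; have [_ E] := dF x xab; rewrite derive1E E.
apply/integrableP; split=> //.
have cvI : ((\int[mu]_(x in I n) (f x)%:E) @[n --> \oo]
    --> \int[mu]_(x in \bigcup_n I n) (f x)%:E)%E.
  apply: ge0_nondecreasing_set_cvg_integral => // n.
  by apply: measurable_funS mEf => //; exact: Isub.
have -> : (\int[mu]_(x in `]a, b[) `|(EFin \o f) x| = \int[mu]_(x in `]a, b[) (f x)%:E)%E.
  by apply: eq_integral => x; rewrite inE /= => /f0 fx; rewrite ger0_norm.
rewrite -Icup; apply: (@le_lt_trans _ _ (F b - F a)%:E); last exact: ltry.
move/cvg_lim : (cvI) => <- //.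
apply: lime_le; first by apply: cvgP cvI.
by apply: nearW => n; exact: bound.
Qed.
End OpenIntervalFTC.

(** * Functions dominated by a power of 1 - x^2 *)

Section JacobiIntegrable.
Context {R : realType}.
Let mu := @lebesgue_measure R.
Implicit Types (f g h : R -> R) (p r x : R).

Lemma cvg_powR0 (T : Type) (F : set_system T) {FF : Filter F} (g : T -> R) r :
  0 < r -> g @ F --> (0 : R) -> (\forall x \near F, 0 < g x) ->
  g x `^ r @[x --> F] --> (0 : R).
Proof.
move=> r0 g0 gpos; apply: (@cvg_comp _ _ _ g (fun y => y `^ r) F (0^'+)); last exact: powR_cvg0.
move=> A hA; have := g0 _ hA.
by apply: filterS2 gpos => x gx; apply.
Qed.

Lemma is_derive_powR_comp (g : R -> R) (x dg r : R) : 0 < g x ->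
  is_derive x (1 : R) g dg ->
  is_derive x (1 : R) (fun y => g y `^ r) (r * g x `^ (r - 1) * dg).
Proof.
move=> gx dgx; have dpow := is_derive1_powR r gx.
exact: (@is_derive1_comp _ (fun z : R => z `^ r) g x _ _ dpow dgx).
Qed.

Lemma continuous_powR_comp (g : R -> R) r x : 0 < g x ->
  {for x, continuous g} -> {for x, continuous (fun y => g y `^ r)}.
Proof.
move=> gx cg; apply: (@continuous_comp _ _ _ g (fun z => z `^ r)) => //.
by apply/differentiable_continuous/derivable1_diffP; case: (is_derive1_powR r gx).
Qed.

(* [(1 - x^2)^p] has no elementary primitive, but it is bounded by this sum. *)
Lemma integrable_jacobi_sum p : - 1 < p ->
  mu.-integrable `]- 1, 1[ (EFin \o (fun x => (1 + x) `^ p + (1 - x) `^ p)).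
Proof.
move=> p1; have p0 : 0 < p + 1 by rewrite -ltrBlDr sub0r.
have d1 (x : R) : -1 < x ->
    is_derive x (1 : R) (fun y : R => (1 + y) `^ (p + 1)) ((p + 1) * (1 + x) `^ p).
  move=> x1; have hx : 0 < 1 + x by rewrite -ltrBlDl sub0r.
  have dg : is_derive x (1 : R) (fun y : R => 1 + y) 1.
    have -> : (fun y : R => 1 + y) = horner (1 + 'X).
      by apply/funext => y; rewrite !hornerE.
    apply: (trigger_derive (is_derive_poly (1 + 'X) x)).
    by rewrite derivD derivX derivC add0r hornerC.
  by have := @is_derive_powR_comp (fun y => 1 + y) x _ (p + 1) hx dg; rewrite addrK mulr1.
have d2 (x : R) : x < 1 ->
    is_derive x (1 : R) (fun y : R => (1 - y) `^ (p + 1)) (- ((p + 1) * (1 - x) `^ p)).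
  move=> x1; have hx : 0 < 1 - x by rewrite subr_gt0.
  have dg : is_derive x (1 : R) (fun y : R => 1 - y) (- 1).
    have -> : (fun y : R => 1 - y) = horner (1 - 'X).
      by apply/funext => y; rewrite !hornerE.
    apply: (trigger_derive (is_derive_poly (1 - 'X) x)).
    by rewrite derivB derivX derivC sub0r hornerN hornerC.
  by have := @is_derive_powR_comp (fun y => 1 - y) x _ (p + 1) hx dg; rewrite addrK mulrN1.
pose F1 (y : R) := (1 + y) `^ (p + 1); pose F2 (y : R) := (1 - y) `^ (p + 1).
pose F := (p + 1)^-1 *: (F1 - F2).
have cont1 (x : R) : -1 < x -> F1 y @[y --> x] --> F1 x.
  by move=> /d1 dx; apply/differentiable_continuous/derivable1_diffP; case: dx.
have cont2 (x : R) : x < 1 -> F2 y @[y --> x] --> F2 x.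
  by move=> /d2 dx; apply/differentiable_continuous/derivable1_diffP; case: dx.
have dF (x : R) : x \in `]- 1, 1[ -> is_derive x (1 : R) F ((1 + x) `^ p + (1 - x) `^ p).
  rewrite in_itv /= => /andP[x1 x2].
  have := is_deriveZ (p + 1)^-1 (is_deriveB (d1 x x1) (d2 x x2)).
  move=> dd; apply: (trigger_derive dd).
  by rewrite /GRing.scale /=; field; rewrite gt_eqF.
have l1 : F1 y @[y --> (-1)^'+] --> F1 (-1).
  rewrite {2}/F1 subrr powR0 ?gt_eqF //; apply: cvg_powR0 => //.
    rewrite -[X in _ --> X](subrr 1); apply: cvg_at_right_filter.
    by apply: cvgD; [exact: cvg_cst|exact: cvg_id].
  near=> y; rewrite -ltrBlDl sub0r; near: y; exact: nbhs_right_gt.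
have l2 : F2 y @[y --> 1^'-] --> F2 1.
  rewrite {2}/F2 subrr powR0 ?gt_eqF //; apply: cvg_powR0 => //.
    rewrite -[X in _ --> X](subrr 1); apply: cvg_at_left_filter.
    by apply: cvgB; [exact: cvg_cst|exact: cvg_id].
  near=> y; rewrite subr_gt0; near: y; exact: nbhs_left_lt.
apply: (@integrable_ge0_derivative_oo _ _ _ F) => //.
- split.
  + by move=> x /dF; case.
  + apply: cvgZr; apply: cvgB => //; apply: cvg_at_right_filter; apply: cont2.
    by rewrite -subr_gt0 opprK.
  + apply: cvgZr; apply: cvgB => //; apply: cvg_at_left_filter; apply: cont1.
    by rewrite -subr_gt0 opprK.
- move=> x; rewrite in_itv /= => /andP[x1 x2]; apply: cvgD.
    apply: (@continuous_powR_comp (fun y => 1 + y)); first by rewrite -ltrBlDl sub0r.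
    by apply: cvgD; [exact: cvg_cst|exact: cvg_id].
  apply: (@continuous_powR_comp (fun y => 1 - y)); first by rewrite subr_gt0.
  by apply: cvgB; [exact: cvg_cst|exact: cvg_id].
- by move=> x _; rewrite addr_ge0 ?powR_ge0.
Unshelve. all: by end_near. Qed.

(** One of the two powers is at most 1: that of v for p >= 0, that of u for p < 0. *)
Lemma powRM_le_sum (u v p : R) : 1 <= u -> 0 < v <= 1 ->
  u `^ p * v `^ p <= u `^ p + v `^ p.
Proof.
move=> u1 v1; have [p0|/ltW p0] := leP 0 p.
  have h : v `^ p <= 1 by rewrite -(powRr0 v) ger_powR.
  by rewrite (le_trans (ler_piMr (powR_ge0 _ _) h)) // lerDl powR_ge0.
have h : u `^ p <= 1 by rewrite -(powRr0 u) ler_powR.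
by rewrite (le_trans (ler_piMl (powR_ge0 _ _) h)) // lerDr powR_ge0.
Qed.

Lemma jacobi_le p x : -1 < x < 1 ->
  (1 - x ^+ 2) `^ p <= (1 + x) `^ p + (1 - x) `^ p.
Proof.
move=> /andP[x1 x2].
have hx1 : 0 < 1 + x by rewrite -ltrBlDl sub0r.
have hx2 : 0 < 1 - x by rewrite subr_gt0.
have -> : 1 - x ^+ 2 = (1 + x) * (1 - x) by ring.
rewrite (powRM _ (ltW hx1) (ltW hx2)); have [x0|x0] := leP 0 x.
  by apply: powRM_le_sum; rewrite ?hx2 ?lerDl // gerBl.
rewrite [leLHS]mulrC [leRHS]addrC; apply: powRM_le_sum; first by rewrite lerDl oppr_ge0 ltW.
by rewrite hx1 gerDl ltW.
Qed.

(** Agreement is required only on the open interval because [derive1] of a function constrained on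
    [-1, 1] is not controlled at the endpoints. *)
Definition cseg f := exists g, {within `[- 1, 1], continuous g} /\
  {in `]- 1, 1[, f =1 g}.

(** A class stable under sums and under products with [cseg] functions, and made of integrable
    functions when p > -1. It provides the integrability of all integrands at once. *)
Definition jac p f := exists g, {within `[- 1, 1], continuous g} /\
  {in `]- 1, 1[, forall x, f x = (1 - x ^+ 2) `^ p * g x}.

Lemma within_segment_continuous g x : {within `[- 1, 1], continuous g} ->
  x \in `]- 1, 1[ -> {for x, continuous g}.
Proof.
have h : (- 1 : R) < 1 by [].
by move=> /(continuous_within_itvP _ h) [+ _ _] => /[apply].
Qed.

Lemma continuous_near_oo f g x : x \in `]- 1, 1[ -> {in `]- 1, 1[, f =1 g} ->
  {for x, continuous g} -> {for x, continuous f}.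
Proof.
move=> xI fg cg; rewrite /prop_for /continuous_at (fg _ xI).
have nf : \near x, g x = f x by near=> y; rewrite fg //; near: y; exact: near_in_itvoo.
by apply: cvg_trans cg; apply: near_eq_cvg.
Unshelve. all: by end_near. Qed.

Lemma jac_continuous p f x : jac p f -> x \in `]- 1, 1[ -> {for x, continuous f}.
Proof.
move=> [g [cg fg]] xI.
apply: (continuous_near_oo xI fg).
have x0 : 0 < 1 - x ^+ 2 by apply: one_sub_sqr_gt0; move: xI; rewrite in_itv.
apply: cvgM; last exact: (within_segment_continuous cg xI).
apply: (@continuous_powR_comp (fun y => 1 - y ^+ 2)) => //.
have -> : (fun y : R => 1 - y ^+ 2) = horner (1 - 'X^2).
  by apply/funext => y; rewrite !hornerE.
exact: continuous_horner.
Qed.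

Lemma jac_integrable p f : - 1 < p -> jac p f -> mu.-integrable `]- 1, 1[ (EFin \o f).
Proof.
move=> p1 jf; have [g [cg fg]] := jf.
have [M hM] : exists M : R, {in `[- 1, 1], forall x, `|g x| <= M}.
  have h : (- 1 : R) <= 1 by [].

  have [c1 _ h1] := EVT_max h cg; have [c2 _ h2] := EVT_min h cg.
  exists (`|g c1| + `|g c2|) => x xI; rewrite ler_norml; apply/andP; split.
    rewrite (le_trans _ (h2 x xI)) // opprD -[leRHS]opprK.
    rewrite -opprD lerN2 (le_trans (ler_norm _)) // normrN lerDr //.
  by rewrite (le_trans (h1 x xI)) // (le_trans (ler_norm _)) // lerDl.
have := integrableZl _ M (integrable_jacobi_sum p1); move=> /(_ (measurable_itv _)).
apply: le_integrable => //.
  apply/measurable_EFinP; apply: open_continuous_measurable_fun => //.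
  by move=> x; rewrite inE => xI; exact: jac_continuous jf xI.
move=> x xI; rewrite /= lee_fin fg //.
have M0 : 0 <= M by rewrite (le_trans (normr_ge0 (g x))) // hM //; exact: subset_itv_oo_cc.
rewrite !normrM (ger0_norm M0) mulrC ler_pM //.
  by rewrite hM //; exact: subset_itv_oo_cc.
rewrite !ger0_norm ?addr_ge0 ?powR_ge0 //.
by apply: jacobi_le; move: xI; rewrite /= in_itv.
Qed.

Lemma cseg_within f : {within `[- 1, 1], continuous f} -> cseg f.
Proof. by move=> cf; exists f. Qed.

Lemma csegD f g : cseg f -> cseg g -> cseg (fun x => f x + g x).
Proof.
move=> [f' [cf Ef]] [g' [cg Eg]]; exists (fun x => f' x + g' x); split.
  by move=> x; apply: cvgD; [exact: cf|exact: cg].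
by move=> x xI; rewrite Ef // Eg.
Qed.

Lemma csegM f g : cseg f -> cseg g -> cseg (fun x => f x * g x).
Proof.
move=> [f' [cf Ef]] [g' [cg Eg]]; exists (fun x => f' x * g' x); split.
  by move=> x; apply: cvgM; [exact: cf|exact: cg].
by move=> x xI; rewrite Ef // Eg.
Qed.

Lemma cseg_cst (c : R) : cseg (fun=> c).
Proof. by apply: cseg_within => x; exact: cvg_cst. Qed.

Lemma csegB f g : cseg f -> cseg g -> cseg (fun x => f x - g x).
Proof.
move=> cf cg; have := csegD cf (csegM (cseg_cst (- 1)) cg).
by under eq_fun do rewrite mulN1r.
Qed.

Lemma jacD p f g : jac p f -> jac p g -> jac p (fun x => f x + g x).
Proof.
move=> [f' [cf Ef]] [g' [cg Eg]]; exists (fun x => f' x + g' x); split.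
  by move=> x; apply: cvgD; [exact: cf|exact: cg].
by move=> x xI; rewrite Ef // Eg // mulrDr.
Qed.

Lemma jacM p f g : jac p f -> cseg g -> jac p (fun x => f x * g x).
Proof.
move=> [f' [cf Ef]] [g' [cg Eg]]; exists (fun x => f' x * g' x); split.
  by move=> x; apply: cvgM; [exact: cf|exact: cg].
by move=> x xI; rewrite Ef // Eg // mulrA.
Qed.

Lemma jac_sum p (I : Type) (s : seq I) (F : I -> R -> R) :
  (forall i, jac p (F i)) -> jac p (fun x => \sum_(i <- s) F i x).
Proof.
move=> jF; elim: s => [|i s IH].
  exists (fun=> 0); split=> x; first exact: cvg_cst.
  by move=> _; rewrite big_nil mulr0.
by under eq_fun do rewrite big_cons; apply: jacD.
Qed.

End JacobiIntegrable.

Section IntegrationByParts.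
Context {R : realType}.
Let mu := @lebesgue_measure R.
Implicit Types (f g u v : R -> R) (x : R).

Definition C1seg u := derivable_oo_LRcontinuous u (- 1) 1 /\ cseg (derive1 u).

Lemma C1seg_cseg u : C1seg u -> cseg u.
Proof. by move=> [/derivable_oo_LRcontinuous_within /cseg_within]. Qed.

Lemma C1seg_is_derive u x : C1seg u -> x \in `]- 1, 1[ ->
  is_derive x (1 : R) u (derive1 u x).
Proof.
by move=> [[du _ _] _] xI; rewrite derive1E; apply/derivableP; apply: du.
Qed.

Lemma C1segD u v : C1seg u -> C1seg v -> C1seg (fun x => u x + v x).
Proof.
move=> cu cv; have [[du lu ru] du'] := cu; have [[dv lv rv] dv'] := cv.
split.
  split; [|exact: cvgD|exact: cvgD].
  by move=> x xI; apply: derivableD; [exact: du|exact: dv].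
have [g [cg Eg]] := csegD du' dv'; exists g; split => // x xI.
rewrite -Eg // derive1E.
by have [_ ->] := is_deriveD (C1seg_is_derive cu xI) (C1seg_is_derive cv xI).
Qed.

Lemma derive1_mul u v x : C1seg u -> C1seg v -> x \in `]- 1, 1[ ->
  derive1 (fun x => u x * v x) x = derive1 u x * v x + u x * derive1 v x.
Proof.
move=> cu cv xI; rewrite derive1E.
have [_ ->] := is_deriveM (C1seg_is_derive cu xI) (C1seg_is_derive cv xI).
by rewrite /GRing.scale /= addrC [v x * _]mulrC.
Qed.

Lemma derive1_add u v x : C1seg u -> C1seg v -> x \in `]- 1, 1[ ->
  derive1 (fun x => u x + v x) x = derive1 u x + derive1 v x.
Proof.
move=> cu cv xI; rewrite derive1E.
by have [_ ->] := is_deriveD (C1seg_is_derive cu xI) (C1seg_is_derive cv xI).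
Qed.

Lemma C1segM u v : C1seg u -> C1seg v -> C1seg (fun x => u x * v x).
Proof.
move=> cu cv; have [[du lu ru] du'] := cu; have [[dv lv rv] dv'] := cv.
split.
  split; [|exact: cvgM|exact: cvgM].
  by move=> x xI; apply: derivableM; [exact: du|exact: dv].
have [g [cg Eg]] := csegD (csegM du' (C1seg_cseg cv)) (csegM (C1seg_cseg cu) dv').
by exists g; split => // x xI; rewrite -Eg // derive1_mul.
Qed.

Lemma C1seg_cst (c : R) : C1seg (fun=> c).
Proof.
split; first by split; [move=> x _; exact: derivable_cst|exact: cvg_cst|exact: cvg_cst].
have [g [cg Eg]] := cseg_cst (0 : R); exists g; split => // x xI.
by rewrite -Eg // (derive1_cst c).
Qed.

(** Integrability is bundled in so that the property passes to finite sums. *)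
Definition null_integral f :=
  mu.-integrable `]- 1, 1[ (EFin \o f) /\ \int[mu]_(x in `]- 1, 1[) f x = 0.

Lemma null_integral_sum (I : Type) (s : seq I) (F : I -> R -> R) :
  (forall i, null_integral (F i)) -> null_integral (fun x => \sum_(i <- s) F i x).
Proof.
move=> nF; elim: s => [|i s [IH1 IH2]].
  under eq_fun do rewrite big_nil; split; first exact: integrable0.
  by rewrite /Rintegral integral0.
have [h1 h2] := nF i; under eq_fun do rewrite big_cons; split.
  by have := integrableD _ h1 IH1; apply; exact: measurable_itv.
by rewrite RintegralD // h2 IH2 addr0.
Qed.

Lemma null_integral_by_parts p w dw u : - 1 < p ->
  derivable_oo_LRcontinuous w (- 1) 1 -> w (- 1) = 0 -> w 1 = 0 ->
  {in `]- 1, 1[, forall x, is_derive x (1 : R) w (dw x)} ->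
  jac p w -> jac p dw -> C1seg u ->
  null_integral (fun x => w x * derive1 u x + dw x * u x).
Proof.
move=> p1 [ew lw rw] w0 w1 dW jw jdw cu; have [[du lu ru] du'] := cu.
have jf : jac p (fun x => w x * derive1 u x + dw x * u x).
  apply: jacD; first exact: jacM.
  by apply: jacM => //; exact: C1seg_cseg.
have fi := jac_integrable p1 jf; split=> //.
transitivity (w 1 * u 1 - w (- 1) * u (- 1)); last by rewrite w0 w1 !mul0r subrr.
apply: (@Rintegral_derivative_oo _ _ _ (fun x => w x * u x)) fi; first by [].
- split; [move=> x xI; apply: derivableM; [exact: ew|exact: du]|exact: cvgM|exact: cvgM].
- move=> x xI.
  apply: (trigger_derive (is_deriveM (dW x xI) (C1seg_is_derive cu xI))).
  by rewrite /GRing.scale /= [u x * _]mulrC.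
- by move=> x xI; exact: jac_continuous jf xI.
Qed.

End IntegrationByParts.

Section WeightRegularity.
Context {R : realType}.
Variables (N : nat) (nu : R).
Hypotheses (N_gt0 : (0 < N)%N) (nu_gt0 : 0 < nu).
Implicit Types (k l : 'I_N.+1).

Lemma weight_succ_boundary k l :
  [/\ derivable_oo_LRcontinuous (fun x => weight N (nu + 1) x k l) (- 1) 1,
      weight N (nu + 1) (- 1) k l = 0 & weight N (nu + 1) 1 k l = 0].
Proof.
have [p [Ep _]] := vsum_poly N (nu + 1) (k : nat)%:Z (l : nat)%:Z.
set C := wconst N (nu + 1) * dfac N k * dfac N l.
have wE x : weight N (nu + 1) x k l = (1 - x ^+ 2) `^ (nu + 1 - 2^-1) * (C *: p).[x].
  by rewrite weightE ?addr_gt0 // Ep hornerZ.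
have r0 : 0 < nu + 1 - 2^-1.
  rewrite -addrA addr_gt0 // subr_gt0 invf_lt1 // ltr1n //.
have z0 : (0 : R) `^ (nu + 1 - 2^-1) = 0 by rewrite powR0 // gt_eqF.
have E1 : weight N (nu + 1) 1 k l = 0 by rewrite wE expr1n subrr z0 mul0r.
have E2 : weight N (nu + 1) (- 1) k l = 0 by rewrite wE sqrrN expr1n subrr z0 mul0r.
have cq (x : R) : (fun y : R => 1 - y ^+ 2) @ x --> 1 - x ^+ 2.
  have -> : (fun y : R => 1 - y ^+ 2) = horner (1 - 'X^2).
    by apply/funext => y; rewrite !hornerE.
  rewrite (_ : 1 - x ^+ 2 = (1 - 'X^2).[x]); last by rewrite !hornerE.
  exact: continuous_horner.
have wf : (fun x => weight N (nu + 1) x k l)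
    = (fun y => (1 - y ^+ 2) `^ (nu + 1 - 2^-1)) * horner (C *: p).
  by apply/funext => y; rewrite wE.
split=> //; split.
- move=> x; rewrite in_itv /= => xI.
  by case: (is_derive_weight N_gt0 nu_gt0 k l xI).
- have A : (1 - y ^+ 2) `^ (nu + 1 - 2^-1) @[y --> (- 1)^'+] --> (0 : R).
    apply: cvg_powR0 => //.
      have := cq (- 1); rewrite sqrrN expr1n subrr; exact: cvg_at_right_filter.
    near=> y; apply: one_sub_sqr_gt0; apply/andP; split.
      by near: y; exact: nbhs_right_gt.
    by near: y; apply: nbhs_right_lt.
  have B : (C *: p).[y] @[y --> (- 1)^'+] --> (C *: p).[- 1].
    by apply: cvg_at_right_filter; exact: continuous_horner.
  have AB := cvgM A B; rewrite mul0r in AB.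
  by rewrite E2 wf; exact: AB.
- have A : (1 - y ^+ 2) `^ (nu + 1 - 2^-1) @[y --> 1^'-] --> (0 : R).
    apply: cvg_powR0 => //.
      have := cq 1; rewrite expr1n subrr; exact: cvg_at_left_filter.
    near=> y; apply: one_sub_sqr_gt0; apply/andP; split.
      by near: y; apply: nbhs_left_gt.
    by near: y; exact: nbhs_left_lt.
  have B : (C *: p).[y] @[y --> 1^'-] --> (C *: p).[1].
    by apply: cvg_at_left_filter; exact: continuous_horner.
  have AB := cvgM A B; rewrite mul0r in AB.
  by rewrite E1 wf; exact: AB.
Unshelve. all: by end_near. Qed.

Lemma jac_poly (r : R) (p : {poly R}) (f : R -> R) :
  (forall x, -1 < x < 1 -> f x = (1 - x ^+ 2) `^ r * p.[x]) -> jac r f.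
Proof.
move=> fE; exists (horner p); split.
  by apply: continuous_subspaceT; exact: continuous_horner.
by move=> x; rewrite in_itv; exact: fE.
Qed.

(** The natural exponent is nu + 1/2. One factor 1 - x^2 is moved into the polynomial so that the
    weight and its derivative share the exponent that [null_integral_by_parts] expects. *)
Lemma jac_weight_succ k l : jac (nu - 2^-1) (fun x => weight N (nu + 1) x k l).
Proof.
have [p [Ep _]] := vsum_poly N (nu + 1) (k : nat)%:Z (l : nat)%:Z.
set C := wconst N (nu + 1) * dfac N k * dfac N l.
apply: (@jac_poly _ (C *: ((1 - 'X^2) * p))) => x xI.
rewrite weight_succE // Ep hornerZ hornerM (_ : (1 - 'X^2).[x] = 1 - x ^+ 2).
  by rewrite -[LHS]mulrA.
by rewrite !hornerE.
Qed.

Lemma jac_weight_Psi k l :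
  jac (nu - 2^-1) (fun x => cconst N nu * (weight N nu x *m Psi N nu x) k l).
Proof.
have [p0 [E0 _]] := vsum_poly N nu (k : nat)%:Z (l : nat)%:Z.
have [p1 [E1 _]] := vsum_poly N nu (k : nat)%:Z ((l : nat)%:Z + 1).
have [p2 [E2 _]] := vsum_poly N nu (k : nat)%:Z ((l : nat)%:Z - 1).
have h2 : N%:R ^+ 2 != 0 :> R by rewrite expf_neq0 // pnatr_eq0 -lt0n.
set C := cconst N nu / N%:R ^+ 2 * (- (2 * (N%:R + 2 * nu + 1))
  * (wconst N nu * dfac N k) * dfac N l).
apply: (@jac_poly _ (C *: ((2 * ((nu + l%:R) * (nu + N%:R - l%:R))) *: ('X * p0)
  - ((l%:R + 1) * (nu + l%:R)) *: p1
  - ((N%:R - l%:R + 1) * (nu + N%:R - l%:R)) *: p2))) => x xI.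
have row m n : weight N nu x m n
  = (1 - x ^+ 2) `^ (nu - 2^-1) * (wconst N nu * dfac N m) * dfac N n
    * vsum N nu x (m : nat)%:Z (n : nat)%:Z by rewrite weightE // !mulrA.
have out (n : int) : (n < 0) || (N%:Z < n) -> vsum N nu x (k : nat)%:Z n = 0.
  exact: vsum_out.
have := mulmx_Psi N_gt0 nu_gt0 (row k) out x l.
rewrite E0 E1 E2 => /(canRL (mulKf h2)) ->.
rewrite hornerZ !(hornerD, hornerN) !hornerZ hornerM hornerX /C.
move: (dfac N k) (dfac N l) (wconst N nu) (_ `^ _) (cconst N nu) p0.[x] p1.[x] p2.[x].
move=> d1 d2 w r c a0 a1 a2.
move: h2; move: (N%:R : R) (l%:R : R) => N' l' h2.
by field; rewrite -sqrf_eq0.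
Qed.

End WeightRegularity.

(** * Complex matrix entries and the adjoint relations *)

Local Open Scope sesquilinear_scope.

Section ComplexEntries.
Context {R : realType}.
Implicit Types (al be x : R) (z w : R[i]).

(* Real and imaginary parts are treated at once, as real-linear forms. *)
Definition rlin al be z : R := al * complex.Re z + be * complex.Im z.

Lemma rlinD al be z w : rlin al be (z + w) = rlin al be z + rlin al be w.
Proof. by case: z w => a b [c d]; rewrite /rlin /=; ring. Qed.

Lemma rlin0 al be : rlin al be 0 = 0.
Proof. by rewrite /rlin /= !mulr0 addr0. Qed.

Lemma rlin_sum al be (I : Type) (s : seq I) (F : I -> R[i]) :
  rlin al be (\sum_(i <- s) F i) = \sum_(i <- s) rlin al be (F i).
Proof. exact: (big_morph _ (rlinD al be) (rlin0 al be)). Qed.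

Lemma rlin_conjM al be z w : rlin al be (z * (w^*)%C)
  = al * (complex.Re z * complex.Re w + complex.Im z * complex.Im w)
    + be * (complex.Im z * complex.Re w - complex.Re z * complex.Im w).
Proof. by case: z w => a b [c d]; rewrite /rlin /=; ring. Qed.

Lemma rlin_real al be (a : R) z w : rlin al be (z * a%:C * (w^*)%C)
  = a * rlin al be (z * (w^*)%C).
Proof. by case: z w => b c [d e]; rewrite /rlin /=; ring. Qed.

Lemma rlin_entry n al be (A : 'M[R]_n) (P Q : 'M[R[i]]_n) i j :
  rlin al be ((P *m toC_mx A *m Q^t*) i j)
  = \sum_k \sum_l A k l * rlin al be (P i k * (Q j l)^*%C).
Proof.
rewrite mxE rlin_sum exchange_big /=; apply: eq_bigr => l _.
rewrite mxE mulr_suml rlin_sum; apply: eq_bigr => k _.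
by rewrite !mxE -rlin_real.
Qed.

Lemma complex_scale (z z' : R[i]) (a b a' b' c : R) :
  z = a +i* b -> z' = a' +i* b' -> a = - c * a' -> b = - c * b' -> z = - c%:C * z'.
Proof.
move=> -> -> -> ->.
by apply/eqP; rewrite eq_complex /= oppr0 !mul0r subr0 addr0 !eqxx.
Qed.

Lemma scale_entry m n (c : R[i]) (A : 'M[R[i]]_(m, n)) i j : (c *: A) i j = c * A i j.
Proof. by rewrite mxE. Qed.

Lemma toC_mxM m n p (A : 'M[R]_(m, n)) (B : 'M[R]_(n, p)) :
  toC_mx (A *m B) = toC_mx A *m toC_mx B.
Proof. exact: map_mxM. Qed.

Lemma adjmxM n (A B : 'M[R[i]]_n) : (A *m B)^t* = B^t* *m A^t*.
Proof. by rewrite trmx_mul map_mxM. Qed.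

End ComplexEntries.

Section Adjoint.
Context {R : realType}.
Let mu := @lebesgue_measure R.

Lemma Ck_segment1_C1seg (u : R -> R) : Ck_segment 1 u -> C1seg u.
Proof. by move=> [du [g [gE cg]]]; split=> //; exists g. Qed.

(** With a, b and c, d the real and imaginary parts of two entries, u is the right side of
    [rlin_conjM]; the second claim is the product rule for it. *)
Lemma C1seg_bilinear (al be : R) (a b c d : R -> R) :
  C1seg a -> C1seg b -> C1seg c -> C1seg d ->
  let u := fun x => al * (a x * c x + b x * d x) + be * (b x * c x - a x * d x) in
  C1seg u /\ {in `]- 1, 1[, forall x, derive1 u x
    = al * (derive1 a x * c x + derive1 b x * d x)
      + be * (derive1 b x * c x - derive1 a x * d x)
      + (al * (a x * derive1 c x + b x * derive1 d x)
      + be * (b x * derive1 c x - a x * derive1 d x))}.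
Proof.
move=> ca cb cc cd /=.
have -> : (fun x => al * (a x * c x + b x * d x) + be * (b x * c x - a x * d x))
  = (fun x => al * (a x * c x + b x * d x) + be * (b x * c x + (- 1) * (a x * d x))).
  by apply/funext => x; rewrite mulN1r.
have Cac := C1segM ca cc; have Cbd := C1segM cb cd.
have Cbc := C1segM cb cc; have Cad := C1segM ca cd.
have Cn := C1segM (C1seg_cst (- 1)) Cad.
have C1 := C1segD Cac Cbd; have C2 := C1segD Cbc Cn.
have C3 := C1segM (C1seg_cst al) C1; have C4 := C1segM (C1seg_cst be) C2.
split; first exact: C1segD.
move=> x xI; rewrite (derive1_add C3 C4 xI).
rewrite (derive1_mul (C1seg_cst al) C1 xI) (derive1_mul (C1seg_cst be) C2 xI).
rewrite (derive1_add Cac Cbd xI) (derive1_add Cbc Cn xI) (derive1_mul (C1seg_cst (- 1)) Cad xI).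
rewrite (derive1_mul ca cc xI) (derive1_mul cb cd xI) (derive1_mul cb cc xI) (derive1_mul ca cd xI).
by rewrite !derive1_cst; ring.
Qed.

Variables (N : nat) (nu : R).
Hypotheses (N_gt0 : (0 < N)%N) (nu_gt0 : 0 < nu).
Implicit Types (P Q : R -> 'M[R[i]]_N.+1).

(** Taking the adjoint of [Sop nu Q x] places Phi and Psi directly after the weight, where c W Phi
    is W^(nu+1) and c W Psi is its derivative. *)
Lemma Sop_entry al be P Q x i j : -1 < x < 1 ->
  cconst N nu * rlin al be ((P x *m toC_mx (weight N nu x) *m (Sop nu Q x)^t*) i j)
  = \sum_k \sum_l (weight N (nu + 1) x k l * rlin al be (P x i k * (deriv_mx Q x j l)^*%C)
      + cconst N nu * (weight N nu x *m Psi N nu x) k l * rlin al be (P x i k * (Q x j l)^*%C)).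
Proof.
move=> xI; rewrite weight_Pearson //.
have -> : P x *m toC_mx (weight N nu x) *m (Sop nu Q x)^t*
  = P x *m toC_mx (weight N nu x *m Phi N nu x) *m (deriv_mx Q x)^t*
    + P x *m toC_mx (weight N nu x *m Psi N nu x) *m (Q x)^t*.
  rewrite /Sop !toC_mxM linearD map_mxD /= !adjmxM !trmxCK mulmxDr.
  by rewrite !mulmxA.
rewrite mxE rlinD !rlin_entry mulrDr !mulr_sumr -big_split; apply: eq_bigr => k _ /=.
rewrite !mulr_sumr -big_split; apply: eq_bigr => l _ /=.
have -> : (cconst N nu *: (weight N nu x *m Phi N nu x)) k l
  = cconst N nu * (weight N nu x *m Phi N nu x) k l by rewrite mxE.
by rewrite !mulrA.
Qed.

Lemma cseg_rlin al be (p q : R -> R[i]) :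
  cseg (fun x => complex.Re (p x)) -> cseg (fun x => complex.Im (p x)) ->
  cseg (fun x => complex.Re (q x)) -> cseg (fun x => complex.Im (q x)) ->
  cseg (fun x => rlin al be (p x * (q x)^*%C)).
Proof.
move=> pr pi qr qi; under eq_fun do rewrite rlin_conjM.
apply: csegD; apply: csegM; try exact: cseg_cst.
  by apply: csegD; apply: csegM.
by apply: csegB; apply: csegM.
Qed.

Lemma integral_adjoint al be P Q i j : Ck_mx 1 P -> Ck_mx 1 Q ->
  \int[mu]_(x in `]- 1, 1[)
    rlin al be ((deriv_mx P x *m toC_mx (weight N (nu + 1) x) *m (Q x)^t*) i j)
  = - cconst N nu * \int[mu]_(x in `]- 1, 1[)
    rlin al be ((P x *m toC_mx (weight N nu x) *m (Sop nu Q x)^t*) i j).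
Proof.
have p1 : - 1 < nu - 2^-1.
  by rewrite ltrBrDl (lt_trans _ nu_gt0) // subr_lt0 invf_lt1 // ltr1n.
move=> CP CQ; set c := cconst N nu.
have c0 : c != 0 by exact: cconst_neq0.
have [Pre Pim] : (forall k, C1seg (fun x => complex.Re (P x i k)))
    /\ (forall k, C1seg (fun x => complex.Im (P x i k))).
  by split=> k; apply: Ck_segment1_C1seg; have [] := CP i k.
have [Qre Qim] : (forall l, C1seg (fun x => complex.Re (Q x j l)))
    /\ (forall l, C1seg (fun x => complex.Im (Q x j l))).
  by split=> k; apply: Ck_segment1_C1seg; have [] := CQ j k.
have dPre k : cseg (fun x => complex.Re (deriv_mx P x i k)).
  by under eq_fun do rewrite mxE; case: (Pre k).
have dPim k : cseg (fun x => complex.Im (deriv_mx P x i k)).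
  by under eq_fun do rewrite mxE; case: (Pim k).
have dQre l : cseg (fun x => complex.Re (deriv_mx Q x j l)).
  by under eq_fun do rewrite mxE; case: (Qre l).
have dQim l : cseg (fun x => complex.Im (deriv_mx Q x j l)).
  by under eq_fun do rewrite mxE; case: (Qim l).
have cs u : C1seg u -> cseg u by exact: C1seg_cseg.
pose w k l x := weight N (nu + 1) x k l.
pose dw k l x := c * (weight N nu x *m Psi N nu x) k l.
set f1 := fun x => rlin al be ((deriv_mx P x *m _ *m _) i j).
set f2 := fun x => rlin al be ((P x *m _ *m (Sop nu Q x)^t*) i j).
(* On ]-1, 1[ this is c times [f2], in a form that is visibly of class [jac]. *)
pose s2 x := \sum_k \sum_l (w k l x * rlin al be (P x i k * (deriv_mx Q x j l)^*%C)
  + dw k l x * rlin al be (P x i k * (Q x j l)^*%C)).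
have jf1 : jac (nu - 2^-1) f1.
  rewrite /f1; under eq_fun do rewrite rlin_entry.
  apply: jac_sum => k; apply: jac_sum => l; apply: jacM; first exact: jac_weight_succ.
  by apply: cseg_rlin => //; apply: cs.
have jf2 : jac (nu - 2^-1) s2.
  apply: jac_sum => k; apply: jac_sum => l; apply: jacD; apply: jacM.
  - exact: jac_weight_succ.
  - by apply: cseg_rlin => //; apply: cs.
  - exact: jac_weight_Psi.
  - by apply: cseg_rlin; apply: cs.
have s2E : {in `]- 1, 1[, forall x, c * f2 x = s2 x}.
  by move=> x; rewrite in_itv /= => xI; rewrite Sop_entry.
have if1 := jac_integrable p1 jf1.
have is2 := jac_integrable p1 jf2.
(* Each summand is the derivative of the (k, l) entry of W^(nu+1) times the real-linear form of
   P_(i,k) and the conjugate of Q_(j,l). The double sum is f1 + s2. *)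
have null : null_integral (fun x => \sum_k \sum_l
    (w k l x * derive1 (fun x => al * (complex.Re (P x i k) * complex.Re (Q x j l)
         + complex.Im (P x i k) * complex.Im (Q x j l))
       + be * (complex.Im (P x i k) * complex.Re (Q x j l)
         - complex.Re (P x i k) * complex.Im (Q x j l))) x
     + dw k l x * (al * (complex.Re (P x i k) * complex.Re (Q x j l)
         + complex.Im (P x i k) * complex.Im (Q x j l))
       + be * (complex.Im (P x i k) * complex.Re (Q x j l)
         - complex.Re (P x i k) * complex.Im (Q x j l))))).
  apply: null_integral_sum => k; apply: null_integral_sum => l.
  have [wb w1 w2] := weight_succ_boundary N_gt0 nu_gt0 k l.
  apply: (null_integral_by_parts p1 wb w1 w2).
  - by move=> x; rewrite in_itv /= => xI; exact: is_derive_weight.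
  - exact: jac_weight_succ.
  - exact: jac_weight_Psi.
  - by have [] := C1seg_bilinear al be (Pre k) (Pim k) (Qre l) (Qim l).
have sum0 : \int[mu]_(x in `]- 1, 1[) (f1 x + s2 x) = 0.
  rewrite -[RHS]null.2; apply: eq_Rintegral => x; rewrite inE /= => xI.
  rewrite /f1 /s2 rlin_entry -big_split; apply: eq_bigr => k _ /=.
  rewrite -big_split; apply: eq_bigr => l _ /=.
  have [_ ->] := C1seg_bilinear al be (Pre k) (Pim k) (Qre l) (Qim l).
    rewrite !rlin_conjM [deriv_mx P x i k]mxE [deriv_mx Q x j l]mxE /=.
    by rewrite -/(w k l x); move: (w k l x) (dw k l x) => w' dw'; ring.
  by [].
rewrite RintegralD // in sum0.
have -> : \int[mu]_(x in `]- 1, 1[) f2 x = c^-1 * \int[mu]_(x in `]- 1, 1[) s2 x.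
  rewrite -RintegralZl //; apply: eq_Rintegral => x; rewrite inE /= => xI.
  by rewrite -s2E // mulKf.
rewrite mulrA mulNr mulfV // mulN1r.
by apply/eqP; rewrite -addr_eq0 sum0.
Qed.

(** The two products are adjoint to each other, so the entries are transposed and conjugate;
    conjugation changes the sign of be. *)
Lemma rlin_entry_sym al be (A : 'M[R]_N.+1) (B C : 'M[R[i]]_N.+1) i j :
  (forall k l, A k l = A l k) ->
  rlin al be ((B *m toC_mx A *m C^t*) i j) = rlin al (- be) ((C *m toC_mx A *m B^t*) j i).
Proof.
move=> symA; rewrite !rlin_entry exchange_big /=.
apply: eq_bigr => k _; apply: eq_bigr => l _; rewrite symA; congr (_ * _).
by rewrite !rlin_conjM; ring.
Qed.

Lemma weight_sym_entry (la x : R) (k l : 'I_N.+1) : weight N la x k l = weight N la x l k.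
Proof. by rewrite !mxE minnC maxnC. Qed.

(** [deriv_mx P] itself need not be of class C^1 on the closed segment, since its endpoint values
    are uncontrolled. P1 is the continuous extension, and equality on an open set carries over to
    derivatives. *)
Lemma Ck_mx2_deriv P : Ck_mx 2 P -> exists P1, Ck_mx 1 P1 /\
  {in `]- 1, 1[, forall x, deriv_mx P x = P1 x /\ deriv_mx (deriv_mx P) x = deriv_mx P1 x}.
Proof.
move=> CP.
have /choice[gr hr] : forall ij, exists g,
    {in `]- 1, 1[, derive1 (fun x => complex.Re (P x ij.1 ij.2)) =1 g} /\ Ck_segment 1 g.
  by move=> [i j]; have [[_ [g hg]] _] := CP i j; exists g.
have /choice[gi hi] : forall ij, exists g,
    {in `]- 1, 1[, derive1 (fun x => complex.Im (P x ij.1 ij.2)) =1 g} /\ Ck_segment 1 g.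
  by move=> [i j]; have [_ [_ [g hg]]] := CP i j; exists g.
exists (fun x => \matrix_(i, j) (gr (i, j) x +i* gi (i, j) x)); split.
  move=> i j; split; under eq_fun do rewrite mxE /=.
    exact: (hr (i, j)).2.
  exact: (hi (i, j)).2.
move=> x xI; split; apply/matrixP => i j; rewrite !mxE.
  by rewrite -(hr (i, j)).1 // -(hi (i, j)).1.
have local (f g : R -> R) : {in `]- 1, 1[, f =1 g} -> derive1 f x = derive1 g x.
  move=> fg; rewrite !derive1E; apply: near_eq_derive.
    by near=> y; apply: fg; near: y; exact: near_in_itvoo.
congr (_ +i* _); apply: local => y yI; rewrite !mxE /=.
  exact: (hr (i, j)).1.
exact: (hi (i, j)).1.
Unshelve. all: by end_near. Qed.

Lemma Ck_mx2_Ck_mx1 P : Ck_mx 2 P -> Ck_mx 1 P.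
Proof.
have W (f : R -> R) : Ck_segment 2 f -> Ck_segment 1 f.
  move=> [df [g [fg [dg _]]]]; split=> //; exists g; split=> //.
  exact: derivable_oo_LRcontinuous_within.
by move=> CP i j; have [h1 h2] := CP i j; split; apply: W.
Qed.

Lemma integral_second_order al be P Q i j : Ck_mx 2 P -> Ck_mx 2 Q ->
  \int[mu]_(x in `]- 1, 1[)
    rlin al be ((Dop nu P x *m toC_mx (weight N nu x) *m (Q x)^t*) i j)
  = - (cconst N nu)^-1 * \int[mu]_(x in `]- 1, 1[)
    rlin al be ((deriv_mx P x *m toC_mx (weight N (nu + 1) x) *m (deriv_mx Q x)^t*) i j).
Proof.
move=> CP CQ; have [P1 [CP1 P1E]] := Ck_mx2_deriv CP.
(* Q is the differentiated argument here and P1 replaces dP/dx inside [Sop]; the swap of i and j and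
   the sign of be anticipate [rlin_entry_sym]. *)
have := integral_adjoint al (- be) j i (Ck_mx2_Ck_mx1 CQ) CP1.
set I1 := (X in X = _ -> _); set I2 := (X in _ = _ * X -> _) => E.
transitivity I2.
  apply: eq_Rintegral => x; rewrite inE /= => /P1E[E1 E2].
  rewrite -rlin_entry_sym; last exact: weight_sym_entry.
  by rewrite /Dop /Sop E2 E1.
transitivity (- (cconst N nu)^-1 * I1).
  by rewrite E mulrA mulrNN mulVf ?mul1r //; exact: cconst_neq0.
congr (_ * _); apply: eq_Rintegral => x; rewrite inE /= => /P1E[E1 _].
by rewrite -rlin_entry_sym ?E1 //; exact: weight_sym_entry.
Qed.

Lemma innerE (la : R) P Q i j : inner la P Q i j
  = (\int[mu]_(x in `]- 1, 1[) rlin 1 0 ((P x *m toC_mx (weight N la x) *m (Q x)^t*) i j))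
    +i* (\int[mu]_(x in `]- 1, 1[) rlin 0 1 ((P x *m toC_mx (weight N la x) *m (Q x)^t*) i j)).
Proof.
rewrite mxE; congr (_ +i* _); apply: eq_Rintegral => x _.
  by rewrite /rlin mul1r mul0r addr0.
by rewrite /rlin mul1r mul0r add0r.
Qed.

Lemma inner_scale (la la' c : R) (P Q P' Q' : R -> 'M[R[i]]_N.+1) :
  (forall al be i j,
    \int[mu]_(x in `]- 1, 1[)
      rlin al be ((P x *m toC_mx (weight N la x) *m (Q x)^t*) i j)
    = - c * \int[mu]_(x in `]- 1, 1[)
      rlin al be ((P' x *m toC_mx (weight N la' x) *m (Q' x)^t*) i j)) ->
  inner la P Q = - c%:C *: inner la' P' Q'.
Proof.
move=> H; apply/matrixP => i j; rewrite scale_entry.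
exact: (complex_scale (innerE la P Q i j) (innerE la' P' Q' i j) (H 1 0 i j) (H 0 1 i j)).
Qed.

End Adjoint.

Theorem corollary2p5 (R : realType) (N : nat) (nu : R)
    (N_gt0 : (0 < N)%N) (nu_gt0 : 0 < nu) :
  (forall P Q : R -> 'M[R[i]]_N.+1, Ck_mx 1 P -> Ck_mx 1 Q ->
    inner (nu + 1) (deriv_mx P) Q
    = - (cconst N nu)%:C *: inner nu P (Sop nu Q)) /\
  (forall P Q : R -> 'M[R[i]]_N.+1, Ck_mx 2 P -> Ck_mx 2 Q ->
    inner nu (Dop nu P) Q
    = - ((cconst N nu)^-1)%:C *: inner (nu + 1) (deriv_mx P) (deriv_mx Q)).
Proof.
split=> P Q CP CQ; apply: inner_scale => al be i j.
  exact: integral_adjoint.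
exact: integral_second_order.
Qed.
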